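(* Let $a,b\in\mathbb{D}$ be distinct and let $\phi\in L^\infty$ be real-valued and non-constant. Then $\Lambda_\phi^{a,b}$ is either empty, a point, or an interval (in $\mathbb{R}$). In particular, $\Lambda_\phi^{a,b}$ is connected.
   Context: $\mathbb{D}$ is the open unit disk, $\mathbb{T}$ the unit circle with normalized Lebesgue measure $\mu$, $L^p=L^p(\mathbb{T},\mu)$, and $H^2$ is the usual Hardy space (identified with analytic functions on $\mathbb{D}$ and, via boundary values, with a subspace of $L^2$). For $t\in\mathbb{C}\setminus\{0\}$, $H^2_t=\{f\in H^2: f(a)=tf(b)\}$, and $P_t$ is the orthogonal projection of $L^2$ onto $H^2_t$. For $\phi\in L^\infty$, the Toeplitz operator $T^t_\phi:H^2_t\to H^2_t$ is $T^t_\phi f=P_t(\phi f)$. $\sigma_p$ denotes point spectrum (set of eigenvalues), and $\Lambda_\phi^{a,b}=\bigcup_{t\in\mathbb{C}\setminus\{0\}}\sigma_p(T^t_\phi)$. Non-constant means not a.e. equal to a constant. *)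

(* Defs.v *)
From HB Require Import structures.
From mathcomp Require Import all_boot all_order all_algebra.
From mathcomp Require Import all_classical all_reals all_analysis.
From mathcomp Require Import complex.
Import Order.TTheory GRing.Theory Num.Theory.
Import numFieldNormedType.Exports.

Set Implicit Arguments.
Unset Strict Implicit.
Unset Printing Implicit Defensive.

Local Open Scope classical_set_scope.
Local Open Scope complex_scope.
Local Open Scope ring_scope.

(* The unit circle carries the measure dx / (2 pi) transported along
   x |-> cos x + i sin x, x in [0, 2 pi].  Elements of L^p are represented by
   functions R[i] -> R[i]; only the values on the circle matter, and only up to
   almost everywhere equality. *)
Section Circle.
Variable R : realType.
Implicit Types (f g h : R[i] -> R[i]) (P : R[i] -> Prop).

Definition cis (x : R) : R[i] := cos x +i* sin x.

Definition arc : set R := `[0, 2 * pi].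

Definition ae_circle P : Prop :=
  {ae lebesgue_measure, forall x : R, arc x -> P (cis x)}.

Definition circle_measurable f : Prop :=
  measurable_fun arc (fun x => complex.Re (f (cis x))) /\
  measurable_fun arc (fun x => complex.Im (f (cis x))).

Definition circle_integral f : R[i] :=
  ((2 * pi)^-1 * \int[lebesgue_measure]_(x in arc) complex.Re (f (cis x)))%R +i*
  ((2 * pi)^-1 * \int[lebesgue_measure]_(x in arc) complex.Im (f (cis x)))%R.

Definition L2 f : Prop :=
  circle_measurable f /\
  (\int[lebesgue_measure]_(x in arc) (complex.Re (`|f (cis x)| ^+ 2))%:E < +oo)%E.

Definition Linfty f : Prop :=
  circle_measurable f /\ exists M : R, ae_circle (fun z => `|f z| <= M%:C).

Definition inner f g : R[i] := circle_integral (fun z => f z * conjc (g z)).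

Definition fourier f (n : int) : R[i] :=
  circle_integral (fun z => f z * z ^ (- n)).

Definition H2 f : Prop :=
  L2 f /\ forall n : nat, fourier f (- (n.+1%:Z)) = 0.

(* The analytic function on the open unit disk whose boundary function is f,
   for f in H2; R[i]^o carries the usual topology of the complex plane. *)
Definition disk_extension f (w : R[i]) : R[i] :=
  limn (fun n : nat =>
    \sum_(0 <= k < n) fourier f k%:Z * w ^+ k : R[i]^o).

Definition H2t (a b t : R[i]) f : Prop :=
  H2 f /\ disk_extension f a = t * disk_extension f b.

(* h is the orthogonal projection of g onto the subspace V of L^2; this
   determines h up to almost everywhere equality. *)
Definition is_orth_proj (V : (R[i] -> R[i]) -> Prop) g h : Prop :=
  V h /\ forall k, V k -> inner (fun z => g z - h z) k = 0.

(* The graph of the Toeplitz operator on H2t a b t with symbol phi. *)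
Definition toeplitz (phi : R[i] -> R[i]) (a b t : R[i]) f g : Prop :=
  H2t a b t f /\ is_orth_proj (H2t a b t) (fun z => phi z * f z) g.

Definition point_spectrum (phi : R[i] -> R[i]) (a b t : R[i]) : set R[i] :=
  [set lambda | exists f, [/\ H2t a b t f, ~ ae_circle (fun z => f z = 0) &
     toeplitz phi a b t f (fun z => lambda * f z)]].

Definition Lambda (phi : R[i] -> R[i]) (a b : R[i]) : set R[i] :=
  \bigcup_(t in [set t | t != 0]) point_spectrum phi a b t.

End Circle.

(* Main.v *)
Require Import Defs.
From HB Require Import structures.
From mathcomp Require Import all_boot all_order all_algebra.
From mathcomp Require Import all_classical all_reals all_analysis.
From mathcomp Require Import measurable_realfun complex ring lra.
Import Order.TTheory GRing.Theory Num.Theory.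
Import numFieldNormedType.Exports.

Set Implicit Arguments.
Unset Strict Implicit.
Unset Printing Implicit Defensive.

Local Open Scope classical_set_scope.
Local Open Scope complex_scope.
Local Open Scope ring_scope.

(* Fix phi real and write u = (phi - lambda) |f|^2 for an eigenvector f of T^t_phi.
   If p is a polynomial with p(a) = p(b), then p f lies in H^2_t, so u is
   orthogonal to p.  Hence lambda is real, the nonnegative Fourier coefficients
   of u are proportional to conj (a^n - b^n), and u is the "dipole"
   Q = 2 Re (d (k_a - k_b)), with k_a the Szego kernel and d a nonzero constant.
   The argument of k_a - k_b increases by 2 pi along the circle, so it takes all
   values.  For eigenvalues lambda_1 < lambda_2 we have Q_2 > 0 ==> Q_1 > 0, which
   then forces d_2 to be a positive multiple of d_1, and after rescaling f_2 both
   have the same Q.  For lambda strictly between, the weight w = Q / (phi - lambda)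
   is positive and at most |f_1|^2 + |f_2|^2, hence integrable, while
   w >= c |q| for a polynomial q with q(0) <> 0.  Szego's extremal problem for w
   then provides f in H^2 with |f|^2 = w (up to a constant) and polynomials
   approximating 1 / f, by which (phi - lambda) f is orthogonal to H^2_t for
   t = f(a) / f(b).  The same extremal problem shows that a nonzero function of
   H^2 is nonzero almost everywhere. *)

(** * The modulus of a complex number and integration over the circle *)

(** Eigenvectors for different [t] live in different spaces and cannot be combined; only their
    squared moduli can. The equation $(\phi-\lambda)|f|^2 = Q$ no longer sees [t], which can be read
    off at the end as $f(a)/f(b)$ from whatever $f$ has been found. Making both eigenvalues share
    one $Q$ opens a gap in the values of $\phi$: almost everywhere $Q > 0$ gives $\phi > \lambda_2$,
    $Q < 0$ gives $\phi < \lambda_1$, and $Q = 0$ would give $\phi = \lambda_1 = \lambda_2$. Hence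
    $\phi-\lambda$ has the sign of $Q$ for every $\lambda$ in between. A function with $|f|^2 = w$
    is classically the outer function built from $\log w$ and its conjugate function. The extremal
    problem obtains it from the completeness of $L^2$ and the uniqueness of Fourier coefficients
    instead. Its minimising polynomials then serve twice as approximate inverses of $f$: they show
    that $f$ has no zero in the disk, so that [t] is defined and nonzero, and they replace a
    division by $f$, whose inverse need not be bounded. *)

Section ComplexModulus.
Variable R : realType.
Implicit Types (x y z : R[i]) (k : R).

(** The norm of [R[i]] has its values in [R[i]]; integrals, square roots and the order of [R] need
    this real-valued copy. *)
Definition absc z : R := complex.Re `|z|.

Lemma normC_absc z : `|z| = (absc z)%:C.
Proof. by case: z. Qed.

Lemma absc_sqr z : absc z ^+ 2 = complex.Re z ^+ 2 + complex.Im z ^+ 2.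
Proof. by apply: complexI; rewrite add_Re2_Im2 normC_absc rmorphXn. Qed.

Lemma absc_ge0 z : 0 <= absc z.
Proof. by rewrite -lecR -normC_absc normr_ge0. Qed.

Lemma absc0 : absc 0 = 0.
Proof. by apply: complexI; rewrite -normC_absc normr0. Qed.

Lemma absc1 : absc 1 = 1.
Proof. by apply: complexI; rewrite -normC_absc normr1. Qed.

Lemma abscM x y : absc (x * y) = absc x * absc y.
Proof. by apply: complexI; rewrite rmorphM/= -!normC_absc normrM. Qed.

Lemma abscX x n : absc (x ^+ n) = absc x ^+ n.
Proof. by apply: complexI; rewrite rmorphXn/= -!normC_absc normrX. Qed.

Lemma abscV x : absc x^-1 = (absc x)^-1.
Proof. by apply: complexI; rewrite fmorphV/= -!normC_absc normfV. Qed.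

Lemma abscN x : absc (- x) = absc x.
Proof. by rewrite /absc normrN. Qed.

Lemma abscB x y : absc (x - y) = absc (y - x).
Proof. by rewrite /absc distrC. Qed.

Lemma abscD x y : absc (x + y) <= absc x + absc y.
Proof. by rewrite -lecR rmorphD/= -!normC_absc ler_normD. Qed.

Lemma absc_eq0 x : (absc x == 0) = (x == 0).
Proof. by rewrite -(normr_eq0 x) normC_absc eq_complex/= eqxx andbT. Qed.

Lemma absc_gt0 x : (0 < absc x) = (x != 0).
Proof. by rewrite lt_def absc_ge0 andbT absc_eq0. Qed.

Lemma absc_real k : absc k%:C = `|k|.
Proof. by rewrite /absc normc_def/= expr0n addr0 sqrtr_sqr. Qed.

Lemma absc_conj z : absc (conjc z) = absc z.
Proof. by rewrite /absc !normc_def; case: z => a b /=; rewrite sqrrN. Qed.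

Lemma normRe_absc z : `|complex.Re z| <= absc z.
Proof.
rewrite -(@ler_pXn2r _ 2) ?nnegrE ?absc_ge0// absc_sqr real_normK ?num_real//.
by rewrite lerDl sqr_ge0.
Qed.

Lemma normIm_absc z : `|complex.Im z| <= absc z.
Proof.
rewrite -(@ler_pXn2r _ 2) ?nnegrE ?absc_ge0// absc_sqr real_normK ?num_real//.
by rewrite lerDr sqr_ge0.
Qed.

Lemma Re_absc z : complex.Re z <= absc z.
Proof. by rewrite (le_trans (ler_norm _))// normRe_absc. Qed.

Lemma absc_ReIm z : absc z <= `|complex.Re z| + `|complex.Im z|.
Proof.
rewrite -(@ler_pXn2r _ 2) ?nnegrE ?absc_ge0 ?addr_ge0// absc_sqr sqrrD.
rewrite !real_normK ?num_real//.
by rewrite -addrA lerD2l addrC lerDl mulrn_wge0// mulr_ge0.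
Qed.

Lemma cReD x y : complex.Re (x + y) = complex.Re x + complex.Re y.
Proof. by case: x; case: y. Qed.

Lemma cImD x y : complex.Im (x + y) = complex.Im x + complex.Im y.
Proof. by case: x; case: y. Qed.

Lemma cReN x : complex.Re (- x) = - complex.Re x.
Proof. by case: x. Qed.

Lemma cImN x : complex.Im (- x) = - complex.Im x.
Proof. by case: x. Qed.

Lemma cReM x y :
  complex.Re (x * y) = complex.Re x * complex.Re y - complex.Im x * complex.Im y.
Proof. by case: x; case: y. Qed.

Lemma cImM x y :
  complex.Im (x * y) = complex.Re x * complex.Im y + complex.Im x * complex.Re y.
Proof. by case: x; case: y. Qed.

Lemma cReJ x : complex.Re (conjc x) = complex.Re x.
Proof. by case: x. Qed.

Lemma cImJ x : complex.Im (conjc x) = - complex.Im x.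
Proof. by case: x. Qed.

Lemma cReC k : complex.Re k%:C = k. Proof. by []. Qed.

Lemma cImC k : complex.Im k%:C = 0. Proof. by []. Qed.

Lemma complex_ext x y :
  complex.Re x = complex.Re y -> complex.Im x = complex.Im y -> x = y.
Proof. by case: x => ? ?; case: y => ? ? /= -> ->. Qed.

Lemma mulc_conj z : z * conjc z = (absc z ^+ 2)%:C.
Proof.
by apply: complex_ext; rewrite ?cReM ?cImM ?cReJ ?cImJ ?cReC ?cImC ?absc_sqr; ring.
Qed.

Lemma absc_cis (t : R) : absc (cis t) = 1.
Proof.
apply: (@pexpIrn _ 2) => //; rewrite ?nnegrE ?absc_ge0//.
by rewrite absc_sqr/= cos2Dsin2 expr1n.
Qed.

Lemma unit_conj z : absc z = 1 -> z * conjc z = 1.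
Proof. by move=> z1; rewrite mulc_conj z1 expr1n. Qed.

Lemma unit_inv z : absc z = 1 -> z^-1 = conjc z.
Proof.
move=> z1; have z0 : z != 0 by rewrite -absc_gt0 z1.
by apply: (mulfI z0); rewrite mulfV// unit_conj.
Qed.

End ComplexModulus.

Section CircleMean.
Variable R : realType.
Implicit Types (F G : R[i] -> R[i]) (u v : R[i] -> R) (z c : R[i]).
Local Notation mu := (@lebesgue_measure R).

#[local] Instance ae_lebesgue_filter : Filter (almost_everywhere mu).
Proof. exact: (ae_filter_ringOfSetsType mu). Qed.

Lemma measurable_arc : measurable (@Defs.arc R : set (measurableTypeR R)).
Proof. exact: measurable_itv. Qed.
Hint Resolve measurable_arc : core.

Definition cmeas u : Prop := measurable_fun (@Defs.arc R) (u \o @cis R).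

Definition cintegrable u : Prop := mu.-integrable (@Defs.arc R) (EFin \o (u \o @cis R)).

Definition cmean u : R := (2 * pi)^-1 * \int[mu]_(x in @Defs.arc R) u (cis x).

Definition CI F : Prop :=
  cintegrable (fun z => complex.Re (F z)) /\ cintegrable (fun z => complex.Im (F z)).

Lemma circle_integralE F : circle_integral F =
  cmean (fun z => complex.Re (F z)) +i* cmean (fun z => complex.Im (F z)).
Proof. by []. Qed.

Lemma tau_gt0 : 0 < (2 * pi)^-1 :> R.
Proof. by rewrite invr_gt0 mulr_gt0// pi_gt0. Qed.

Lemma mu_arc : mu (@Defs.arc R) = (2 * pi)%:E.
Proof.
rewrite lebesgue_measure_itv/= lte_fin mulr_gt0 ?pi_gt0//.
by rewrite oppr0 adde0.
Qed.

Lemma cintegrable_meas u : cintegrable u -> cmeas u.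
Proof. by move=> /measurable_int/measurable_EFinP. Qed.

Lemma cmeas_cst k : cmeas (fun=> k).
Proof. exact: measurable_cst. Qed.

Lemma cmeasD u v : cmeas u -> cmeas v -> cmeas (fun z => u z + v z).
Proof. by move=> mu' mv; exact: measurable_funD. Qed.

Lemma cmeasB u v : cmeas u -> cmeas v -> cmeas (fun z => u z - v z).
Proof. by move=> mu' mv; exact: measurable_funB. Qed.

Lemma cmeasM u v : cmeas u -> cmeas v -> cmeas (fun z => u z * v z).
Proof. by move=> mu' mv; exact: measurable_funM. Qed.

Lemma cmeasX u n : cmeas u -> cmeas (fun z => u z ^+ n).
Proof. by move=> mu'; exact: measurable_funX. Qed.

Lemma cmeas_norm u : cmeas u -> cmeas (fun z => `|u z|).
Proof. by move=> mu'; apply: measurableT_comp. Qed.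

Lemma cmeas_sqrt u : cmeas u -> cmeas (fun z => Num.sqrt (u z)).
Proof.
move=> mu'; apply: (measurableT_comp _ mu').
by apply: continuous_measurable_fun; exact: sqrt_continuous.
Qed.

Lemma cmeasV u : cmeas u -> cmeas (fun z => (u z)^-1).
Proof.
move=> mu'.
(* Squaring makes the base of the real power nonnegative, where exponent -1 is the inverse. At a
   zero of [u] both sides are 0. *)
have -> : (fun z => (u z)^-1) = (fun z => u z * (u z ^+ 2) `^ (-1)).
  apply/funext => z; rewrite powR_inv1 ?sqr_ge0//.
  have [->|u0] := eqVneq (u z) 0; first by rewrite invr0 mul0r.
  by rewrite expr2 invfM mulrA mulfV ?mul1r.
apply: cmeasM => //.
exact: (measurableT_comp (@measurable_powR R (- 1)) (measurable_funX 2 mu')).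
Qed.

Lemma cmeas_if u v (b : R[i] -> bool) : measurable_fun (@Defs.arc R) (b \o @cis R) ->
  cmeas u -> cmeas v -> cmeas (fun z => if b z then u z else v z).
Proof.
move=> mb mu' mv; apply: measurable_fun_if => //.
- by apply: measurable_funS mu' => //; apply: subIsetl.
- by apply: measurable_funS mv => //; apply: subIsetl.
Qed.

Lemma ae_circleW (P : R[i] -> Prop) : (forall z, absc z = 1 -> P z) -> ae_circle P.
Proof. by move=> h; apply: aeW => x _; apply: h; exact: absc_cis. Qed.

Lemma ae_circleS (P Q : R[i] -> Prop) : (forall z, absc z = 1 -> P z -> Q z) ->
  ae_circle P -> ae_circle Q.
Proof.
move=> h; rewrite /ae_circle; apply: filterS => x Px ax.
by apply: h; [exact: absc_cis|exact: Px].
Qed.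

Lemma ae_circle2 (P Q S : R[i] -> Prop) :
  (forall z, absc z = 1 -> P z -> Q z -> S z) ->
  ae_circle P -> ae_circle Q -> ae_circle S.
Proof.
move=> h; rewrite /ae_circle; apply: filterS2 => x Px Qx ax.
by apply: h; [exact: absc_cis|exact: Px|exact: Qx].
Qed.

Lemma cintegrable_le u v : cmeas u -> cintegrable v ->
  ae_circle (fun z => `|u z| <= v z) -> cintegrable u.
Proof.
move=> mu' iv uv; apply/integrableP; split; first exact/measurable_EFinP.
have /integrableP[mv] := iv; apply: le_lt_trans.
apply: ae_ge0_le_integral => //=.
- by apply/measurable_EFinP; exact: measurableT_comp.
- by apply/measurable_EFinP; apply: measurableT_comp => //; exact/measurable_EFinP.
- move: uv; rewrite /ae_circle; apply: filterS => x uv ax.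
  rewrite lee_fin (le_trans (uv ax))//=.
  exact: ler_norm.
Qed.

Lemma cintegrable_cst k : cintegrable (fun=> k).
Proof.
apply: measurable_bounded_integrable => //.
- by rewrite [X in (X < _)%E]mu_arc ltry.
- exact: cmeas_cst.
- exists `|k|; split; first exact: num_real.
  by move=> M kM x _ /=; exact: ltW.
Qed.

Lemma cintegrableD u v :
  cintegrable u -> cintegrable v -> cintegrable (fun z => u z + v z).
Proof. by move=> iu iv; exact: (integrableD _ iu iv). Qed.

Lemma cintegrableZ k u : cintegrable u -> cintegrable (fun z => k * u z).
Proof. by move=> iu; exact: (integrableZl _ _ iu). Qed.

Lemma cintegrableN u : cintegrable u -> cintegrable (fun z => - u z).
Proof. by move=> iu; exact: (integrableN iu). Qed.

Lemma cintegrableB u v :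
  cintegrable u -> cintegrable v -> cintegrable (fun z => u z - v z).
Proof. by move=> iu iv; apply: cintegrableD => //; exact: cintegrableN. Qed.

Lemma cintegrable_norm u : cintegrable u -> cintegrable (fun z => `|u z|).
Proof. by move=> iu; exact: (integrable_norm iu). Qed.

Lemma cmeanD u v : cintegrable u -> cintegrable v ->
  cmean (fun z => u z + v z) = cmean u + cmean v.
Proof. by move=> iu iv; rewrite /cmean RintegralD// mulrDr. Qed.

Lemma cmeanZ k u : cintegrable u -> cmean (fun z => k * u z) = k * cmean u.
Proof. by move=> iu; rewrite /cmean RintegralZl// mulrCA. Qed.

Lemma cmeanN u : cintegrable u -> cmean (fun z => - u z) = - cmean u.
Proof.
move=> iu; rewrite -mulN1r -cmeanZ//; congr cmean.
by apply/funext => z; rewrite mulN1r.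
Qed.

Lemma cmeanB u v : cintegrable u -> cintegrable v ->
  cmean (fun z => u z - v z) = cmean u - cmean v.
Proof. by move=> iu iv; rewrite cmeanD ?cmeanN//; exact: cintegrableN. Qed.

Lemma cmean_cst k : cmean (fun=> k) = k.
Proof.
rewrite /cmean Rintegral_cst// mulrCA.
by rewrite [X in fine X]mu_arc/= mulVf ?mulr1// mulf_neq0// ?gt_eqF// pi_gt0.
Qed.

Lemma cmean_ae u v : cmeas u -> cmeas v ->
  ae_circle (fun z => u z = v z) -> cmean u = cmean v.
Proof.
move=> mu' mv uv; rewrite /cmean; congr (_ * _); rewrite /Rintegral; congr fine.
apply: ae_eq_integral => //; try exact/measurable_EFinP.
by move: uv; rewrite /ae_circle; apply: filterS => x uv /uv; rewrite /= => ->.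
Qed.

Lemma eq_cmean u v : (forall z, absc z = 1 -> u z = v z) -> cmean u = cmean v.
Proof.
move=> uv; rewrite /cmean; congr (_ * _); apply: eq_Rintegral => x _.
by apply: uv; exact: absc_cis.
Qed.

Lemma cmean_ge0 u : (forall z, absc z = 1 -> 0 <= u z) -> 0 <= cmean u.
Proof.
move=> u0; rewrite /cmean mulr_ge0 ?(ltW tau_gt0)//.
by apply: Rintegral_ge0 => x _; apply: u0; exact: absc_cis.
Qed.

Lemma cmean_le u v : cintegrable u -> cintegrable v ->
  ae_circle (fun z => u z <= v z) -> cmean u <= cmean v.
Proof.
move=> iu iv uv; rewrite -subr_ge0 -cmeanB//.
have iB := cintegrableB iv iu.
(* The difference is nonnegative only almost everywhere; its absolute value agrees with it there and
   is nonnegative at every point, as [cmean_ge0] asks. *)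
rewrite (_ : cmean _ = cmean (fun z => `|v z - u z|)); first exact: cmean_ge0.
apply: cmean_ae; first exact: cintegrable_meas.
  by apply: cintegrable_meas; exact: cintegrable_norm.
by apply: ae_circleS uv => z _ uv; rewrite ger0_norm// subr_ge0.
Qed.

Lemma cmean_eq0 u : cintegrable u -> (forall z, absc z = 1 -> 0 <= u z) ->
  cmean u = 0 -> ae_circle (fun z => u z = 0).
Proof.
move=> iu u0 /eqP; rewrite /cmean mulf_eq0 gt_eqF ?tau_gt0//= => /eqP h.
have fin := integrable_fin_num measurable_arc iu.
have fi := fineK fin; rewrite [X in X%:E = _]h in fi.
have /ae_eq_integral_abs : (\int[mu]_(x in @Defs.arc R) `|(u (cis x))%:E|)%E = 0%E.
  rewrite [RHS]fi; apply: eq_integral => x _ /=.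
  by rewrite ger0_norm// u0// absc_cis.
move=> /(_ measurable_arc).
have mu' := measurable_int _ iu.
by move=> /(_ mu'); rewrite /ae_circle; apply: filterS => x h0 /h0[].
Qed.

Lemma circle_measurable_cst c : circle_measurable (fun=> c).
Proof. by split; exact: cmeas_cst. Qed.

Lemma circle_measurable_id : circle_measurable (fun z : R[i] => z).
Proof.
split; apply: measurable_funTS; apply: continuous_measurable_fun => x.
- exact: continuous_cos.
- exact: continuous_sin.
Qed.

Lemma circle_measurable_real u : cmeas u -> circle_measurable (fun z => (u z)%:C).
Proof. by move=> mu'; split => //; exact: cmeas_cst. Qed.

Lemma eq_circle_measurable F G :
  F =1 G -> circle_measurable F -> circle_measurable G.
Proof. by move=> /funext->. Qed.

Lemma circle_measurableD F G : circle_measurable F -> circle_measurable G ->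
  circle_measurable (fun z => F z + G z).
Proof.
move=> [F1 F2] [G1 G2]; split.
- by under eq_fun do rewrite cReD; exact: measurable_funD.
- by under eq_fun do rewrite cImD; exact: measurable_funD.
Qed.

Lemma circle_measurableM F G : circle_measurable F -> circle_measurable G ->
  circle_measurable (fun z => F z * G z).
Proof.
move=> [F1 F2] [G1 G2]; split.
- under eq_fun do rewrite cReM.
  by apply: measurable_funB; exact: measurable_funM.
- under eq_fun do rewrite cImM.
  by apply: measurable_funD; exact: measurable_funM.
Qed.

Lemma circle_measurableZ c F :
  circle_measurable F -> circle_measurable (fun z => c * F z).
Proof. by move=> mF; apply: circle_measurableM => //; exact: circle_measurable_cst. Qed.

Lemma circle_measurableN F :
  circle_measurable F -> circle_measurable (fun z => - F z).
Proof.
move=> mF; apply: eq_circle_measurable (circle_measurableZ (- 1) mF) => z.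
by rewrite mulN1r.
Qed.

Lemma circle_measurableB F G : circle_measurable F -> circle_measurable G ->
  circle_measurable (fun z => F z - G z).
Proof.
by move=> mF mG; apply: circle_measurableD => //; exact: circle_measurableN.
Qed.

Lemma circle_measurableJ F :
  circle_measurable F -> circle_measurable (fun z => conjc (F z)).
Proof.
move=> [F1 F2]; split; first by under eq_fun do rewrite cReJ.
under eq_fun do rewrite cImJ.
by apply: (measurableT_comp _ F2); exact: oppr_measurable.
Qed.

Lemma circle_measurableX F n :
  circle_measurable F -> circle_measurable (fun z => F z ^+ n).
Proof.
move=> mF; elim: n => [|n ih]; first exact: circle_measurable_cst.
apply: eq_circle_measurable (circle_measurableM mF ih) => z.
by rewrite exprS.
Qed.

Lemma circle_measurable_horner (p : {poly R[i]}) :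
  circle_measurable (fun z => p.[z]).
Proof.
elim/poly_ind: p => [|p c ih].
  apply: eq_circle_measurable (circle_measurable_cst 0) => z.
  by rewrite horner0.
apply: eq_circle_measurable (circle_measurableD
  (circle_measurableM ih circle_measurable_id) (circle_measurable_cst c)) => z.
by rewrite hornerMXaddC.
Qed.

Lemma cmeas_absc2 F : circle_measurable F -> cmeas (fun z => absc (F z) ^+ 2).
Proof.
move=> [F1 F2]; rewrite /cmeas.
rewrite [X in measurable_fun _ X](_ : _ = (fun x =>
  complex.Re (F (cis x)) ^+ 2 + complex.Im (F (cis x)) ^+ 2)).
  by apply: measurable_funD; exact: measurable_funX.
by apply/funext => x /=; rewrite absc_sqr.
Qed.

Lemma cmeas_absc F : circle_measurable F -> cmeas (fun z => absc (F z)).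
Proof.
move=> /cmeas_absc2/cmeas_sqrt; rewrite /cmeas.
rewrite [X in measurable_fun _ X -> _](_ : _ = (fun z => absc (F z)) \o @cis R)//.
by apply/funext => x /=; rewrite sqrtr_sqr ger0_norm// absc_ge0.
Qed.

Lemma circle_measurableV F :
  circle_measurable F -> circle_measurable (fun z => (F z)^-1).
Proof.
move=> mF; have : circle_measurable
    (fun z => ((absc (F z) ^+ 2)^-1)%:C * conjc (F z)).
  apply: circle_measurableM; last exact: circle_measurableJ.
  by apply: circle_measurable_real; apply: cmeasV; exact: cmeas_absc2.
apply: eq_circle_measurable => z.
have [->|F0] := eqVneq (F z) 0.
  by rewrite rmorph0 mulr0 invr0.
apply: (mulfI F0); rewrite mulfV// mulrCA mulc_conj -rmorphM/=.
by rewrite mulVf// expf_neq0// absc_eq0.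
Qed.

Lemma CI_meas F : CI F -> circle_measurable F.
Proof. by move=> [/cintegrable_meas ? /cintegrable_meas ?]; split. Qed.

Lemma CI_le F v : circle_measurable F -> cintegrable v ->
  ae_circle (fun z => absc (F z) <= v z) -> CI F.
Proof.
move=> [F1 F2] iv Fv; split.
- apply: (cintegrable_le F1 iv); apply: ae_circleS Fv => z _.
  by apply: le_trans; exact: normRe_absc.
- apply: (cintegrable_le F2 iv); apply: ae_circleS Fv => z _.
  by apply: le_trans; exact: normIm_absc.
Qed.

Lemma CI_absc F : CI F -> cintegrable (fun z => absc (F z)).
Proof.
move=> [F1 F2]; have := cintegrableD (cintegrable_norm F1) (cintegrable_norm F2).
move=> /cintegrable_le; apply.
  by apply: cmeas_absc; apply: CI_meas; split.
by apply: ae_circleW => z _; rewrite ger0_norm ?absc_ge0 ?absc_ReIm.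
Qed.

Lemma CI_real u : cintegrable u -> CI (fun z => (u z)%:C).
Proof. by move=> iu; split => //; exact: cintegrable_cst. Qed.

Lemma eq_CI F G : F =1 G -> CI F -> CI G.
Proof. by move=> /funext->. Qed.

Lemma CID F G : CI F -> CI G -> CI (fun z => F z + G z).
Proof.
move=> [F1 F2] [G1 G2]; split.
- by under eq_fun do rewrite cReD; exact: cintegrableD.
- by under eq_fun do rewrite cImD; exact: cintegrableD.
Qed.

Lemma CIZ c F : CI F -> CI (fun z => c * F z).
Proof.
move=> [F1 F2]; split.
- by under eq_fun do rewrite cReM; apply: cintegrableB; exact: cintegrableZ.
- by under eq_fun do rewrite cImM; apply: cintegrableD; exact: cintegrableZ.
Qed.

Lemma CIN F : CI F -> CI (fun z => - F z).
Proof. by move=> iF; apply: eq_CI (CIZ (- 1) iF) => z; rewrite mulN1r. Qed.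

Lemma CIB F G : CI F -> CI G -> CI (fun z => F z - G z).
Proof. by move=> iF iG; apply: CID => //; exact: CIN. Qed.

Lemma CIJ F : CI F -> CI (fun z => conjc (F z)).
Proof.
move=> [F1 F2]; split; first by under eq_fun do rewrite cReJ.
by under eq_fun do rewrite cImJ; exact: cintegrableN.
Qed.

Lemma circle_integralD F G : CI F -> CI G ->
  circle_integral (fun z => F z + G z) = circle_integral F + circle_integral G.
Proof.
move=> [F1 F2] [G1 G2]; rewrite !circle_integralE; apply: complex_ext => /=.
- by rewrite -cmeanD//; apply: eq_cmean => z _; rewrite cReD.
- by rewrite -cmeanD//; apply: eq_cmean => z _; rewrite cImD.
Qed.

Lemma circle_integralZ c F : CI F ->
  circle_integral (fun z => c * F z) = c * circle_integral F.
Proof.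
move=> [F1 F2]; rewrite !circle_integralE; apply: complex_ext; rewrite ?cReM ?cImM/=.
- rewrite -!cmeanZ// -cmeanB; try exact: cintegrableZ.
  by apply: eq_cmean => z _; rewrite cReM.
- rewrite -!cmeanZ// -cmeanD; try exact: cintegrableZ.
  by apply: eq_cmean => z _; rewrite cImM.
Qed.

Lemma circle_integralN F : CI F ->
  circle_integral (fun z => - F z) = - circle_integral F.
Proof.
move=> iF; rewrite -mulN1r -circle_integralZ//; congr circle_integral.
by apply/funext => z; rewrite mulN1r.
Qed.

Lemma circle_integralB F G : CI F -> CI G ->
  circle_integral (fun z => F z - G z) = circle_integral F - circle_integral G.
Proof. by move=> iF iG; rewrite circle_integralD ?circle_integralN//; exact: CIN. Qed.

Lemma circle_integralJ F : CI F ->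
  circle_integral (fun z => conjc (F z)) = conjc (circle_integral F).
Proof.
move=> [F1 F2]; rewrite !circle_integralE; apply: complex_ext => /=.
- by apply: eq_cmean => z _; rewrite cReJ.
- by rewrite -cmeanN//; apply: eq_cmean => z _; rewrite cImJ.
Qed.

Lemma circle_integral_real u :
  circle_integral (fun z => (u z)%:C) = (cmean u)%:C.
Proof.
by rewrite circle_integralE; apply: complex_ext => //=; rewrite cmean_cst.
Qed.

Lemma circle_integral_cst c : circle_integral (fun=> c) = c.
Proof. by rewrite circle_integralE !cmean_cst; case: c. Qed.

Lemma eq_circle_integral F G : (forall z, absc z = 1 -> F z = G z) ->
  circle_integral F = circle_integral G.
Proof.
move=> FG; rewrite !circle_integralE; congr (_ +i* _);
by apply: eq_cmean => z z1; rewrite FG.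
Qed.

Lemma circle_integral_ae F G : circle_measurable F -> circle_measurable G ->
  ae_circle (fun z => F z = G z) -> circle_integral F = circle_integral G.
Proof.
move=> [F1 F2] [G1 G2] FG; rewrite !circle_integralE; congr (_ +i* _);
by apply: cmean_ae => //; apply: ae_circleS FG => z _ ->.
Qed.

(* Rotate the integral onto the positive half-line, where it is the mean of a
   real part. *)
Lemma absc_circle_integral F : CI F ->
  absc (circle_integral F) <= cmean (fun z => absc (F z)).
Proof.
move=> iF; set I := circle_integral F.
have [->|I0] := eqVneq I 0.
  by rewrite absc0; apply: cmean_ge0 => z _; exact: absc_ge0.
have A0 : absc I != 0 by rewrite absc_eq0.
pose c := conjc I / (absc I)%:C.
have c1 : absc c = 1.
  by rewrite abscM abscV absc_conj absc_real ger0_norm ?absc_ge0// mulfV.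
have cI : (absc I) = complex.Re (circle_integral (fun z => c * F z)).
  rewrite circle_integralZ// -/I /c mulrAC [_ * I]mulrC mulc_conj.
  by rewrite -fmorphV -rmorphM/= expr2 mulfK.
rewrite cI circle_integralE/=; apply: cmean_le.
- by have [] := CIZ c iF.
- exact: CI_absc.
- apply: ae_circleW => z _; rewrite (le_trans (Re_absc _))// abscM c1.
  by rewrite mul1r.
Qed.

End CircleMean.
#[global] Hint Resolve measurable_arc : core.
#[global] Existing Instance ae_lebesgue_filter.

(** * Uniqueness of Fourier coefficients *)

Section BoundedMultipliers.
Variable R : realType.
Implicit Types (F G : R[i] -> R[i]) (u v : R[i] -> R).

Lemma CI_bounded_mul F G (M : R) : CI F -> circle_measurable G ->
  (forall z, absc z = 1 -> absc (G z) <= M) -> CI (fun z => F z * G z).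
Proof.
move=> iF mG GM; apply: (@CI_le _ _ (fun z => M * absc (F z))).
- by apply: circle_measurableM => //; exact: CI_meas.
- by apply: cintegrableZ; exact: CI_absc.
- apply: ae_circleW => z z1; rewrite abscM mulrC ler_wpM2r ?absc_ge0//.
  exact: GM.
Qed.

Lemma cintegrable_bounded_mul u v (M : R) : cintegrable u -> cmeas v ->
  (forall z, absc z = 1 -> `|v z| <= M) -> cintegrable (fun z => u z * v z).
Proof.
move=> iu mv vM; apply: (@cintegrable_le _ _ (fun z => M * `|u z|)).
- by apply: cmeasM => //; exact: cintegrable_meas.
- by apply: cintegrableZ; exact: cintegrable_norm.
- by apply: ae_circleW => z z1; rewrite normrM mulrC ler_wpM2r// vM.
Qed.

Lemma CI_unit_pow F n : CI F -> CI (fun z => F z * z ^+ n).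
Proof.
move=> iF; apply: (@CI_bounded_mul _ _ 1) => //.
  by apply: circle_measurableX; exact: circle_measurable_id.
by move=> z z1; rewrite abscX z1 expr1n.
Qed.

Lemma CI_unit_powJ F n : CI F -> CI (fun z => F z * conjc z ^+ n).
Proof.
move=> iF; apply: (@CI_bounded_mul _ _ 1) => //.
  by apply/circle_measurableX/circle_measurableJ; exact: circle_measurable_id.
by move=> z z1; rewrite abscX absc_conj z1 expr1n.
Qed.

Lemma horner_bounded (p : {poly R[i]}) :
  exists M : R, forall z : R[i], absc z = 1 -> absc p.[z] <= M.
Proof.
elim/poly_ind: p => [|p c [M hM]].
  by exists 0 => z _; rewrite horner0 absc0.
exists (M + absc c) => z z1; rewrite hornerMXaddC (le_trans (abscD _ _))//.
by rewrite lerD2r abscM z1 mulr1 hM.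
Qed.

Lemma CI_horner F (p : {poly R[i]}) : CI F -> CI (fun z => F z * p.[z]).
Proof.
move=> iF; have [M hM] := horner_bounded p.
by apply: (@CI_bounded_mul _ _ M) => //; exact: circle_measurable_horner.
Qed.

End BoundedMultipliers.

Section StepPolynomials.
Variable R : realType.
Implicit Types (t : R) (n : nat).

Lemma bernoulli_ineq (y : R) n : 0 <= y <= 1 -> 1 - n%:R * y <= (1 - y) ^+ n.
Proof.
move=> /andP[y0 y1]; elim: n => [|n ih]; first by rewrite mul0r subr0 expr0.
have h : (1 - y) * (1 - n%:R * y) <= (1 - y) ^+ n.+1.
  by rewrite exprS ler_wpM2l// subr_ge0.
apply: le_trans h; rewrite -natr1 -subr_ge0.
have -> : (1 - y) * (1 - n%:R * y) - (1 - (n%:R + 1) * y) = n%:R * y ^+ 2.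
  by ring.
by rewrite mulr_ge0// sqr_ge0.
Qed.

Lemma bernoulli_ineq_pos (y : R) n : 0 <= y -> 1 + n%:R * y <= (1 + y) ^+ n.
Proof.
move=> y0; elim: n => [|n ih]; first by rewrite mul0r addr0 expr0.
have h : (1 + y) * (1 + n%:R * y) <= (1 + y) ^+ n.+1.
  by rewrite exprS ler_wpM2l// addr_ge0.
apply: le_trans h; rewrite -natr1 -subr_ge0.
have -> : (1 + y) * (1 + n%:R * y) - (1 + (n%:R + 1) * y) = n%:R * y ^+ 2.
  by ring.
by rewrite mulr_ge0// sqr_ge0.
Qed.

(* The Brosowski-Deutsch polynomials, which approximate on [0, 1] the
   indicator function of ]1/2, 1]. *)
Definition step n t : R := 1 - (1 - t ^+ n) ^+ (2 ^ n).

Lemma step_bound n t : 0 <= t <= 1 -> 0 <= step n t <= 1.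
Proof.
move=> /andP[t0 t1]; rewrite /step subr_ge0 gerBl.
have h0 : 0 <= 1 - t ^+ n by rewrite subr_ge0 exprn_ile1.
by rewrite exprn_ge0// andbT exprn_ile1// gerBl exprn_ge0.
Qed.

(** Bernoulli's inequality with exponent $2^n$ bounds [step n t] by $2^n t^n$. *)
Lemma step_cvg0 t : 0 <= t -> t < 2^-1 -> (step n t @[n --> \oo] --> (0 : R)).
Proof.
move=> t0 t2.
have t1 : t <= 1 by apply: ltW; apply: (lt_trans t2); lra.
apply: (@squeeze_cvgr _ _ _ _ (fun=> 0) (fun n => (2 * t) ^+ n)).
- near=> n; have /andP[-> _] : 0 <= step n t <= 1 by apply: step_bound; rewrite t0.
  rewrite /= /step lerBlDr -lerBlDl exprMn -natrX.
  by apply: bernoulli_ineq; rewrite exprn_ge0//= exprn_ile1.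
- exact: cvg_cst.
- by apply: cvg_expr; rewrite ger0_norm ?mulr_ge0//; lra.
Unshelve. all: by end_near. Qed.

(** Bernoulli gives $(2t)^n \le (1+t^n)^{2^n}$, so $(1-t^n)^{2^n}(2t)^n \le (1-t^{2n})^{2^n} \le 1$,
    and $1 - $ [step n t] is at most $(2t)^{-n}$. *)
Lemma step_cvg1 t : 2^-1 < t -> t <= 1 -> (step n t @[n --> \oo] --> (1 : R)).
Proof.
move=> t2 t1; have t0 : 0 < t by apply: lt_trans t2; rewrite invr_gt0.
apply: (@squeeze_cvgr _ _ _ _ (fun n => 1 - ((2 * t)^-1) ^+ n) (fun=> 1)).
- near=> n; have /andP[_ ->] : 0 <= step n t <= 1.
    by apply: step_bound; rewrite ltW.
  rewrite andbT /step lerD2l lerN2 exprVn.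
  have tn0 : 0 < t ^+ n by rewrite exprn_gt0.
  have t2n : 0 < (2 * t) ^+ n by rewrite exprn_gt0// mulr_gt0.
  rewrite -[leRHS]mul1r ler_pdivlMr//.
  have h1 : (2 * t) ^+ n <= (1 + t ^+ n) ^+ (2 ^ n).
    apply: le_trans (bernoulli_ineq_pos _ (ltW tn0)).
    by rewrite exprMn natrX lerDr.
  have h2 : 0 <= (1 - t ^+ n) ^+ (2 ^ n).
    by rewrite exprn_ge0// subr_ge0 exprn_ile1// ltW.
  apply: (le_trans (ler_wpM2l h2 h1)); rewrite -exprMn exprn_ile1//.
    apply: mulr_ge0; first by rewrite subr_ge0 exprn_ile1// ltW.
    by rewrite addr_ge0// ltW.
  have -> : (1 - t ^+ n) * (1 + t ^+ n) = 1 - (t ^+ n) ^+ 2 by ring.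
  by rewrite gerBl sqr_ge0.
- rewrite -[X in _ --> X]subr0; apply: cvgB; first exact: cvg_cst.
  apply: cvg_expr; rewrite ger0_norm ?invr_ge0 ?mulr_ge0 ?(ltW t0)//.
  by rewrite invf_lt1 ?mulr_gt0//; lra.
- exact: cvg_cst.
Unshelve. all: by end_near. Qed.

End StepPolynomials.

Section FourierUniqueness.
Variable R : realType.
Implicit Types (F G : R[i] -> R[i]) (u v : R[i] -> R).
Local Notation mu := (@lebesgue_measure R).

(** Trigonometric polynomials: on the circle [conjc z ^+ n] is $z^{-n}$. Closure under sums and
    products allows [step n] to be applied to [bump m]. *)
Definition laurent F : Prop := exists (n : nat) (p : {poly R[i]}),
  forall z, absc z = 1 -> F z = conjc z ^+ n * p.[z].

Lemma laurent_cst c : laurent (fun=> c).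
Proof. by exists 0, c%:P => z _; rewrite expr0 mul1r hornerC. Qed.

Lemma laurent_id : laurent (fun z => z).
Proof. by exists 0, 'X => z _; rewrite expr0 mul1r hornerX. Qed.

Lemma laurent_conj : laurent (fun z => conjc z).
Proof. by exists 1%N, 1 => z _; rewrite expr1 hornerC mulr1. Qed.

Lemma laurentM F G : laurent F -> laurent G -> laurent (fun z => F z * G z).
Proof.
move=> [n [p hp]] [m [q hq]]; exists (n + m)%N, (p * q) => z z1.
by rewrite hp// hq// hornerM exprD mulrACA.
Qed.

Lemma laurentD F G : laurent F -> laurent G -> laurent (fun z => F z + G z).
Proof.
move=> [n [p hp]] [m [q hq]]; exists (n + m)%N, (p * 'X^m + q * 'X^n) => z z1.
rewrite hp// hq// hornerD !hornerM !hornerXn exprD mulrDr.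
have h k : conjc z ^+ k * z ^+ k = 1.
  by rewrite -exprMn mulrC unit_conj// expr1n.
congr (_ + _).
- rewrite -{1}[p.[z]]mul1r -(h m); ring.
- rewrite -{1}[q.[z]]mul1r -(h n); ring.
Qed.

Lemma laurentB F G : laurent F -> laurent G -> laurent (fun z => F z - G z).
Proof.
move=> lF lG; have := laurentD lF (laurentM (laurent_cst (- 1)) lG).
by move=> [n [p h]]; exists n, p => z z1; rewrite -h// mulN1r.
Qed.

Lemma laurentX F n : laurent F -> laurent (fun z => F z ^+ n).
Proof.
move=> lF; elim: n => [|n ih]; first exact: laurent_cst.
have [m [p h]] := laurentM lF ih.
by exists m, p => z z1; rewrite -h// exprS.
Qed.

(** As [u] is real, conjugation turns its moments against $z^n$ into those against $\bar z^n$, so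
    the moments of both signs vanish. *)
Lemma laurent_annihilated u F : cintegrable u ->
  (forall n, circle_integral (fun z => (u z)%:C * z ^+ n) = 0) ->
  laurent F -> circle_integral (fun z => (u z)%:C * F z) = 0.
Proof.
move=> iu u0 [n [p hp]].
have iuC := CI_real iu.
have uJ0 k : circle_integral (fun z => (u z)%:C * conjc z ^+ k) = 0.
  rewrite (@eq_circle_integral _ _ (fun z => conjc ((u z)%:C * z ^+ k))).
    by rewrite circle_integralJ ?u0 ?rmorph0//; exact: CI_unit_pow.
  by move=> z _; rewrite rmorphM rmorphXn /= oppr0.
have unm k l : circle_integral (fun z => (u z)%:C * (conjc z ^+ k * z ^+ l)) = 0.
  have h z j : absc z = 1 -> conjc z ^+ j * z ^+ j = 1.
    by move=> z1; rewrite -exprMn mulrC unit_conj// expr1n.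
  have [kl|lk] := leqP k l.
    rewrite -[RHS](u0 (l - k)%N); apply: eq_circle_integral => z z1.
    by rewrite -{1}(subnKC kl) exprD [conjc z ^+ k * _]mulrA h// mul1r.
  rewrite -[RHS](uJ0 (k - l)%N); apply: eq_circle_integral => z z1.
  rewrite -{1}(subnKC (ltnW lk)) exprD.
  by rewrite [conjc z ^+ l * _]mulrC -[_ * _ * z ^+ l]mulrA h// mulr1.
(* The additional power [m] makes the induction on [p] go through: passing from [p] to [p * 'X + c]
   raises it by one. *)
have : forall m, circle_integral
    (fun z => (u z)%:C * (conjc z ^+ n * z ^+ m * p.[z])) = 0.
  elim/poly_ind: p {hp} => [m|p c ih m].
    rewrite -[RHS](circle_integral_cst 0); apply: eq_circle_integral => z _.
    by rewrite horner0 !mulr0.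
  rewrite (@eq_circle_integral _ _ (fun z =>
      (u z)%:C * (conjc z ^+ n * z ^+ m.+1 * p.[z]) +
      c * ((u z)%:C * (conjc z ^+ n * z ^+ m)))); last first.
    by move=> z z1; rewrite hornerMXaddC exprS; ring.
  have i1 q j : CI (fun z => (u z)%:C * (conjc z ^+ n * z ^+ j * q.[z])).
    apply: eq_CI (CI_horner q (CI_unit_pow j (CI_unit_powJ n iuC))) => z /=.
    by rewrite !mulrA.
  have i2 j : CI (fun z => (u z)%:C * (conjc z ^+ n * z ^+ j)).
    by apply: eq_CI (CI_unit_pow j (CI_unit_powJ n iuC)) => z; rewrite mulrA.
  by rewrite circle_integralD ?circle_integralZ ?ih ?unm ?mulr0 ?addr0//;
     exact: CIZ.
move=> /(_ 0) <-; apply: eq_circle_integral => z z1.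
by rewrite hp// expr0 mulr1.
Qed.

(* Along the circle, [bump m] exceeds 1/2 exactly on the open arc from angle 0
   to angle 2 m. *)
Definition bump (m : R) (z : R[i]) : R :=
  2^-1 + (complex.Re (z * conjc (cis m)) - cos m) / 4.

Lemma bump_laurent m : laurent (fun z => (bump m z)%:C).
Proof.
have h : laurent (fun z => (2^-1)%:C + ((8^-1)%:C *
    (z * conjc (cis m) + conjc z * cis m) - (cos m / 4)%:C)).
  apply: laurentD; first exact: laurent_cst.
  apply: laurentB; last exact: laurent_cst.
  apply: laurentM; first exact: laurent_cst.
  apply: laurentD; apply: laurentM; try exact: laurent_cst.
  - exact: laurent_id.
  - exact: laurent_conj.
have [n [p hp]] := h; exists n, p => z z1; rewrite -hp// /bump.
apply: complex_ext; rewrite !(cReD, cImD, cReM, cImM, cReN, cImN, cReJ, cImJ, cReC, cImC);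
by field.
Qed.

(** Product form of the difference of cosines. For [x] strictly between 0 and $2\pi$ the first sine
    is positive, so the sign of [bump - 1/2] is that of the second sine, hence of [s - x]. *)
Lemma bumpE s x :
  bump (s / 2) (cis x) = 2^-1 + (sin (x / 2) * sin ((s - x) / 2)) / 2.
Proof.
rewrite /bump cReM cReJ cImJ /=.
have -> : cos x * cos (s / 2) - sin x * - sin (s / 2) = cos (x - s / 2).
  by rewrite cosB; ring.
have -> : x - s / 2 = x / 2 - (s - x) / 2 by field.
have -> : s / 2 = x / 2 + (s - x) / 2 by field.
by rewrite cosB cosD; field.
Qed.

Lemma bump_bound m z : absc z = 1 -> 0 <= bump m z <= 1.
Proof.
move=> z1; rewrite /bump.
have : `|complex.Re (z * conjc (cis m))| <= 1.
  by rewrite (le_trans (normRe_absc _))// abscM z1 absc_conj absc_cis mulr1.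
rewrite ler_norml => /andP[h1 h2].
have h3 := cos_le1 m; have h4 := cos_geN1 m.
by apply/andP; split; lra.
Qed.

Lemma cmeas_bump m : cmeas (bump m).
Proof.
apply: cmeasD; first exact: cmeas_cst.
apply: cmeasM; last exact: cmeas_cst.
apply: cmeasB; last exact: cmeas_cst.
have [] : circle_measurable (fun z : R[i] => z * conjc (cis m)) => //.
apply: circle_measurableM; first exact: circle_measurable_id.
exact: circle_measurable_cst.
Qed.

Lemma bump_step_annihilated u n m : cintegrable u ->
  (forall n, circle_integral (fun z => (u z)%:C * z ^+ n) = 0) ->
  cmean (fun z => u z * step n (bump m z)) = 0.
Proof.
move=> iu u0; apply: complexI; rewrite -circle_integral_real.
rewrite -[RHS](laurent_annihilated iu u0
  (laurentB (laurent_cst 1) (laurentX (2 ^ n)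
  (laurentB (laurent_cst 1) (laurentX n (bump_laurent m)))))).
apply: eq_circle_integral => z _.
by rewrite /step rmorphM rmorphB rmorphXn rmorphB rmorphXn !rmorph1.
Qed.

Lemma ae_neq (r : R) : {ae mu, forall x : R, x <> r}.
Proof.
exists [set r]; split.
- exact: measurable_set1.
- exact: lebesgue_measure_set1.
- by move=> x /= /contrapT.
Qed.

(** Dominated convergence with majorant [|u|]: [step n] of [bump (s / 2)] tends to the indicator of
    the arc from 0 to [s], except at the angles 0, [s] and $2\pi$, where [bump] is exactly 1/2. *)
Lemma initial_arc_integral0 u (s : R) : cintegrable u ->
  (forall n, circle_integral (fun z => (u z)%:C * z ^+ n) = 0) ->
  0 < s < 2 * pi -> \int[mu]_(x in `[0, s]) u (cis x) = 0.
Proof.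
move=> iu u0 /andP[s0 s2].
pose f_ n (x : R) := (u (cis x) * step n (bump (s / 2) (cis x)))%:E.
pose f (x : R) := (((u \o @cis R) \_ `[0, s]) x)%:E.
have mu' : cmeas u by exact: cintegrable_meas.
have marc := @measurable_arc R.
have mf_ n : measurable_fun (@Defs.arc R : set (measurableTypeR R)) (f_ n).
  apply/measurable_EFinP.
  suff : cmeas (fun z => u z * step n (bump (s / 2) z)) by [].
  apply: cmeasM => //; apply: cmeasB; first exact: cmeas_cst.
  apply: cmeasX; apply: cmeasB; first exact: cmeas_cst.
  by apply: cmeasX; exact: cmeas_bump.
have mf : measurable_fun (@Defs.arc R : set (measurableTypeR R)) f.
  apply/measurable_EFinP/measurable_restrict => //.
  by apply: measurable_funS mu' => //; exact: subIsetl.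
have ig : mu.-integrable (@Defs.arc R : set (measurableTypeR R))
    (EFin \o (fun x => `|u (cis x)|)) by exact: (cintegrable_norm iu).
have cv : {ae mu, forall x : R, @Defs.arc R x -> f_ n x @[n --> \oo] --> f x}.
  apply: (@filterS _ (almost_everywhere mu) _ _ _ _
    (filterI (ae_neq (2 * pi)) (filterI (ae_neq 0) (ae_neq s)))) => x [x2p [x0 xs]].
  rewrite /Defs.arc /= in_itv/= => /andP[x0' x2].
  have {x0' x0}x0 : 0 < x by rewrite lt_neqAle x0' andbT eq_sym; exact/eqP.
  have {x2p x2}x2 : x < 2 * pi by rewrite lt_neqAle x2 andbT; exact/eqP.
  have sx2 : 0 < sin (x / 2).
    by apply: sin_gt0_pi; rewrite divr_gt0//= ltr_pdivrMr// mulrC.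
  have /andP[b0 b1] := bump_bound (s / 2) (absc_cis x).
  apply: cvg_EFin; first by near=> n.
  rewrite /f patchE; case: ifPn => [|/negP] xi /=.
    have {xi xs}xs : x < s.
      move: xi; rewrite inE/= in_itv/= => /andP[_ xs'].
      by rewrite lt_neqAle xs' andbT; exact/eqP.
    have s1 : 0 < sin ((s - x) / 2).
      apply: sin_gt0_pi; rewrite divr_gt0 ?subr_gt0//= ltr_pdivrMr// mulrC.
      by rewrite ltrBlDr (lt_trans s2)// ltrDl.
    rewrite -[X in _ --> X]mulr1; apply: cvgM; first exact: cvg_cst.
    apply: step_cvg1 => //; rewrite bumpE ltrDl.
    by rewrite divr_gt0// mulr_gt0.
  have {xi xs}xs : s < x.
    rewrite ltNge; apply/negP => xs'; apply: xi.
    by rewrite inE/= in_itv/= (ltW x0).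
  have s1 : sin ((s - x) / 2) < 0.
    rewrite -oppr_gt0 -sinN -mulNr opprB.
    apply: sin_gt0_pi; rewrite divr_gt0 ?subr_gt0//= ltr_pdivrMr// mulrC.
    by rewrite ltrBlDr (lt_trans x2)// ltrDl.
  rewrite -[X in _ --> X](mulr0 (u (cis x))); apply: cvgM; first exact: cvg_cst.
  apply: step_cvg0 => //; rewrite bumpE gtrDl.
  by rewrite pmulr_llt0// nmulr_llt0.
have aef : {ae mu, forall (x : R) (n : nat), @Defs.arc R x ->
    (`|f_ n x| <= (`|u (cis x)|%R)%:E)%E}.
  apply: aeW => x n _; rewrite /f_ /= lee_fin normrM ler_piMr//.
  have /andP[h1 h2] := step_bound n (bump_bound (s / 2) (absc_cis x)).
  by rewrite ger0_norm.
have [_ _] := dominated_convergence marc mf_ mf cv ig aef.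
have -> : [sequence (\int[mu]_(x in @Defs.arc R) f_ n x)%E]_n = (fun=> 0%E).
  apply/funext => n /=.
  have iuN : cintegrable (fun z => u z * step n (bump (s / 2) z)).
    apply: (@cintegrable_bounded_mul _ _ _ 1) => //; last first.
      move=> z z1; have /andP[h1 h2] := step_bound n (bump_bound (s / 2) z1).
      by rewrite ger0_norm.
    apply: cmeasB; first exact: cmeas_cst.
    apply: cmeasX; apply: cmeasB; first exact: cmeas_cst.
    by apply: cmeasX; exact: cmeas_bump.
  have := bump_step_annihilated n (s / 2) iu u0.
  move=> /eqP; rewrite /cmean mulf_eq0 gt_eqF ?tau_gt0//= => /eqP h.
  have fi := fineK (integrable_fin_num marc iuN).
  by rewrite [X in X%:E = _]h in fi; exact: (esym fi).
move=> h.
have : (\int[mu]_(x in @Defs.arc R) f x)%E = 0%E.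
  by apply/esym; apply: cvg_unique h; [exact: ereal_hausdorff|exact: cvg_cst].
have -> : \int[mu]_(x in `[0, s]) u (cis x) =
    \int[mu]_(x in @Defs.arc R) ((u \o @cis R) \_ `[0, s]) x.
  rewrite -Rintegral_mkcondr; congr Rintegral.
  apply/seteqP; split => x /=; rewrite /Defs.arc/= !in_itv/=.
    by move=> /andP[-> xs]; split => //; rewrite (le_trans xs)// ltW.
  by case.
by rewrite /Rintegral => ->.
Unshelve. all: by end_near. Qed.

(** The primitive of [u] vanishes on all initial arcs, and by Lebesgue differentiation its
    derivative is [u] almost everywhere. *)
Lemma fourier_uniqueness u : cintegrable u ->
  (forall n, circle_integral (fun z => (u z)%:C * z ^+ n) = 0) ->
  ae_circle (fun z => u z = 0).
Proof.
move=> iu u0; pose f := (u \o @cis R) \_ (@Defs.arc R).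
have lf : locally_integrable [set: R] f.
  by apply: integrable_locally => //; exact: measurable_arc.
have fE x : @Defs.arc R x -> f x = u (cis x) by move=> ax; rewrite /f patchE mem_set.
have intf : mu.-integrable [set` Interval (BLeft 0) (BRight (2 * pi : R))] (EFin \o f).
  apply: eq_integrable iu; first exact: measurable_arc.
  by move=> x; rewrite inE => ax /=; rewrite fE.
rewrite /ae_circle.
apply: (@filterS _ (almost_everywhere mu) _ _ _ _ (filterI (ae_neq (2 * pi))
  (filterI (ae_neq 0) (lebesgue_differentiation lf)))) => x [x2p [x0 lx]].
rewrite /Defs.arc /= in_itv/= => /andP[x0' x2].
have ax : @Defs.arc R x by rewrite /Defs.arc/= in_itv/= x0'.
have {x0' x0}x0 : 0 < x by rewrite lt_neqAle x0' andbT eq_sym; exact/eqP.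
have {x2p x2}x2 : x < 2 * pi by rewrite lt_neqAle x2 andbT; exact/eqP.
rewrite -fE//.
have [_ <-] := FTC1_lebesgue_pt x2 intf x0 lx.
rewrite derive1E (@near_eq_derive _ _ _ _ (cst 0)) ?derive_cst//.
near=> y.
have y0 : 0 < y by near: y; exact: lt_nbhsr.
have y2 : y < 2 * pi by near: y; exact: lt_nbhsl.
rewrite /= -[RHS](initial_arc_integral0 iu u0 (s := y)) ?y0//.
apply: eq_Rintegral => t; rewrite inE/= in_itv/= => /andP[t0 ty].
by rewrite fE// /Defs.arc/= in_itv/= t0 (le_trans ty)// ltW.
Unshelve. all: by end_near. Qed.

End FourierUniqueness.

(** * Square-integrable functions and evaluation on the disk *)

Section SquareIntegrable.
Variable R : realType.
Implicit Types (F G : R[i] -> R[i]) (u v : R[i] -> R) (c : R[i]).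

Definition nrm2 F : R := cmean (fun z => absc (F z) ^+ 2).

Lemma L2E F : L2 F <->
  circle_measurable F /\ cintegrable (fun z => absc (F z) ^+ 2).
Proof.
have h x : complex.Re (`|F (cis x)| ^+ 2) = absc (F (cis x)) ^+ 2.
  by rewrite normC_absc -rmorphXn.
split=> -[mF iF]; split => //.
- apply/integrableP; split; first by apply/measurable_EFinP; exact: cmeas_absc2.
  apply: le_lt_trans iF; rewrite le_eqVlt; apply/orP; left; apply/eqP.
  by apply: eq_integral => x _; rewrite h/= ger0_norm// sqr_ge0.
- have /integrableP[_] := iF; apply: le_lt_trans.
  rewrite le_eqVlt; apply/orP; left; apply/eqP.
  by apply: eq_integral => x _; rewrite h/= ger0_norm// sqr_ge0.
Qed.

Lemma L2_meas F : L2 F -> circle_measurable F.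
Proof. by case. Qed.

Lemma L2_absc2 F : L2 F -> cintegrable (fun z => absc (F z) ^+ 2).
Proof. by move=> /L2E[]. Qed.

Lemma nrm2_ge0 F : 0 <= nrm2 F.
Proof. by apply: cmean_ge0 => z _; exact: sqr_ge0. Qed.

Lemma eq_L2 F G : F =1 G -> L2 F -> L2 G.
Proof. by move=> /funext->. Qed.

Lemma L2_le F v : circle_measurable F -> cintegrable v ->
  ae_circle (fun z => absc (F z) ^+ 2 <= v z) -> L2 F.
Proof.
move=> mF iv Fv; apply/L2E; split => //.
apply: (cintegrable_le (cmeas_absc2 mF) iv).
by apply: ae_circleS Fv => z _; rewrite ger0_norm ?sqr_ge0.
Qed.

Lemma absc_sqrD (x y : R[i]) : absc (x + y) ^+ 2 <= 2 * absc x ^+ 2 + 2 * absc y ^+ 2.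
Proof.
have h : absc (x + y) ^+ 2 <= (absc x + absc y) ^+ 2.
  by rewrite lerXn2r ?nnegrE ?addr_ge0 ?absc_ge0 ?abscD.
apply: (le_trans h).
have := sqr_ge0 (absc x - absc y); rewrite sqrrB sqrrD; lra.
Qed.

Lemma absc_mul_le (x y : R[i]) : absc (x * y) <= absc x ^+ 2 + absc y ^+ 2.
Proof.
rewrite abscM; have := sqr_ge0 (absc x - absc y); rewrite sqrrB.
have := sqr_ge0 (absc x); have := sqr_ge0 (absc y); lra.
Qed.

Lemma L2D F G : L2 F -> L2 G -> L2 (fun z => F z + G z).
Proof.
move=> /L2E[mF iF] /L2E[mG iG].
apply: (L2_le (circle_measurableD mF mG)
  (cintegrableD (cintegrableZ 2 iF) (cintegrableZ 2 iG))).
by apply: ae_circleW => z _; exact: absc_sqrD.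
Qed.

Lemma L2_bounded_mul F G (M : R) : L2 F -> circle_measurable G ->
  (forall z, absc z = 1 -> absc (G z) <= M) -> L2 (fun z => F z * G z).
Proof.
move=> /L2E[mF iF] mG GM.
apply: (L2_le (circle_measurableM mF mG) (cintegrableZ (M ^+ 2) iF)).
apply: ae_circleW => z z1; rewrite abscM exprMn mulrC ler_wpM2r ?sqr_ge0//.
have h := GM _ z1; rewrite lerXn2r// nnegrE ?absc_ge0//.
exact: le_trans (absc_ge0 _) h.
Qed.

Lemma L2_cst c : L2 (fun=> c).
Proof.
apply: (L2_le (circle_measurable_cst c) (cintegrable_cst (absc c ^+ 2))).
exact: ae_circleW.
Qed.

Lemma L2Z c F : L2 F -> L2 (fun z => c * F z).
Proof.
move=> lF; apply: (@eq_L2 (fun z => F z * c)) => [z|]; first by rewrite mulrC.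
exact: (@L2_bounded_mul _ _ (absc c) lF (circle_measurable_cst c)).
Qed.

Lemma L2B F G : L2 F -> L2 G -> L2 (fun z => F z - G z).
Proof.
move=> lF lG; apply: eq_L2 (L2D lF (L2Z (- 1) lG)) => z.
by rewrite mulN1r.
Qed.

Lemma L2J F : L2 F -> L2 (fun z => conjc (F z)).
Proof.
move=> /L2E[mF iF]; apply: (L2_le (circle_measurableJ mF) iF).
by apply: ae_circleW => z _; rewrite absc_conj.
Qed.

Lemma L2_CI_mul F G : L2 F -> L2 G -> CI (fun z => F z * G z).
Proof.
move=> /L2E[mF iF] /L2E[mG iG].
apply: (CI_le (circle_measurableM mF mG) (cintegrableD iF iG)).
by apply: ae_circleW => z _; exact: absc_mul_le.
Qed.

Lemma L2_CI F : L2 F -> CI F.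
Proof.
by move=> lF; apply: eq_CI (L2_CI_mul lF (L2_cst 1)) => z; rewrite mulr1.
Qed.

Lemma L2_horner F (p : {poly R[i]}) : L2 F -> L2 (fun z => F z * p.[z]).
Proof.
move=> lF; have [M hM] := horner_bounded p.
by apply: (@L2_bounded_mul _ _ M) => //; exact: circle_measurable_horner.
Qed.

Lemma cauchy_schwarz F G : L2 F -> L2 G ->
  absc (circle_integral (fun z => F z * G z)) ^+ 2 <= nrm2 F * nrm2 G.
Proof.
move=> lF lG; have iFG := L2_CI_mul lF lG.
have h1 := absc_circle_integral iFG.
set B := cmean _ in h1; set A := nrm2 F; set C := nrm2 G.
have A0 : 0 <= A := nrm2_ge0 F.
have C0 : 0 <= C := nrm2_ge0 G.
have B0 : 0 <= B by apply: cmean_ge0 => z _; exact: absc_ge0.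
suff h : B ^+ 2 <= A * C.
  by apply: le_trans h; rewrite lerXn2r ?nnegrE ?absc_ge0.
have q t : 0 <= t ^+ 2 * A - 2 * t * B + C.
  have iF := L2_absc2 lF; have iG := L2_absc2 lG; have iM := CI_absc iFG.
  have -> : t ^+ 2 * A - 2 * t * B + C = cmean (fun z =>
     t ^+ 2 * absc (F z) ^+ 2 - 2 * t * absc (F z * G z) + absc (G z) ^+ 2).
    rewrite cmeanD//; last by apply: cintegrableB; exact: cintegrableZ.
    by rewrite cmeanB ?cmeanZ//; exact: cintegrableZ.
  apply: cmean_ge0 => z _; rewrite abscM.
  have -> : t ^+ 2 * absc (F z) ^+ 2 - 2 * t * (absc (F z) * absc (G z)) +
    absc (G z) ^+ 2 = (t * absc (F z) - absc (G z)) ^+ 2 by ring.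
  exact: sqr_ge0.
(* The quadratic [q] is least at [B / A]. For [A = 0] it is affine, and if [B] is nonzero the chosen
   argument gives it the value -1. *)
have [A00|An0] := eqVneq A 0.
  have [->|Bn0] := eqVneq B 0; first by rewrite expr0n/= mulr_ge0.
  have := q ((C + 1) / (2 * B)); rewrite A00 mulr0 sub0r.
  have -> : 2 * ((C + 1) / (2 * B)) * B = C + 1 by field.
  lra.
have := q (B / A).
have -> : (B / A) ^+ 2 * A - 2 * (B / A) * B + C = (A * C - B ^+ 2) / A by field.
by rewrite pmulr_lge0 ?subr_ge0// invr_gt0 lt_def An0.
Qed.

Lemma mean_le_nrm2 F : L2 F -> absc (circle_integral F) ^+ 2 <= nrm2 F.
Proof.
move=> lF; have := cauchy_schwarz lF (L2_cst 1).
have -> : nrm2 (fun=> 1) = 1 :> R.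
  by rewrite /nrm2 absc1 expr1n cmean_cst.
rewrite mulr1 (_ : circle_integral _ = circle_integral F)//.
by apply: eq_circle_integral => z _; rewrite mulr1.
Qed.

End SquareIntegrable.

Section Evaluation.
Variable R : realType.
Implicit Types (F G : R[i] -> R[i]) (u v : R[i] -> R) (a b c d : R[i]).

Lemma cvg_absc (f : nat -> R[i]) (l : R[i]) :
  (absc (l - f n) @[n --> \oo] --> (0 : R)) ->
  ((f n : R[i]^o) @[n --> \oo] --> (l : R[i]^o)).
Proof.
move=> /cvgrPdist_lt h; apply/cvgrPdist_lt => e e0.
(* In the partial order of [R[i]] a positive element is a positive real. *)
have [e1 e2] : complex.Im e = 0 /\ 0 < complex.Re e.
  by move: e0; rewrite ltcE/= => /andP[/eqP-> ->].
near=> n.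
have : `|0 - absc (l - f n)| < complex.Re e by near: n; exact: h.
rewrite sub0r normrN ger0_norm ?absc_ge0// => lt_e.
by rewrite [`|_|]normC_absc ltcE/= e1 eqxx.
Unshelve. all: by end_near. Qed.

Definition szego a (z : R[i]) : R[i] := (1 - conjc a * z)^-1.

Lemma szego_den_ge a z : absc z = 1 -> 1 - absc a <= absc (1 - conjc a * z).
Proof.
move=> z1; have := abscD (1 - conjc a * z) (conjc a * z).
by rewrite subrK absc1 abscM absc_conj z1 mulr1 -lerBlDr.
Qed.

Lemma szego_den_neq0 a z : absc a < 1 -> absc z = 1 -> 1 - conjc a * z != 0.
Proof.
move=> a1 z1; rewrite -absc_gt0 (lt_le_trans _ (szego_den_ge a z1))//.
by rewrite subr_gt0.
Qed.

Lemma szego_bound a z : absc a < 1 -> absc z = 1 -> absc (szego a z) <= (1 - absc a)^-1.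
Proof.
move=> a1 z1; rewrite /szego abscV lef_pV2 ?posrE ?subr_gt0 ?absc_gt0//.
  exact: szego_den_ge.
exact: szego_den_neq0.
Qed.

Lemma szegoJ a z : conjc (szego a z) = (1 - a * conjc z)^-1.
Proof. by rewrite /szego fmorphV rmorphB rmorph1 rmorphM/= conjcK. Qed.

Lemma szego_denJ_neq0 a z : absc a < 1 -> absc z = 1 -> 1 - a * conjc z != 0.
Proof.
move=> a1 z1; have := szego_den_neq0 a1 z1; rewrite -conjc_eq0.
by rewrite rmorphB rmorph1 rmorphM/= conjcK.
Qed.

Lemma circle_measurable_szego a : circle_measurable (szego a).
Proof.
apply: circle_measurableV; apply: circle_measurableB.
  exact: circle_measurable_cst.
by apply: circle_measurableZ; exact: circle_measurable_id.
Qed.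

Lemma CI_szego a F : absc a < 1 -> CI F -> CI (fun z => F z * szego a z).
Proof.
move=> a1 iF; apply: (CI_bounded_mul iF (circle_measurable_szego a)) => z z1.
exact: szego_bound.
Qed.

Lemma CI_szegoJ a F : absc a < 1 -> CI F -> CI (fun z => F z * conjc (szego a z)).
Proof.
move=> a1 iF.
apply: (CI_bounded_mul iF (circle_measurableJ (circle_measurable_szego a))) => z z1.
by rewrite absc_conj; exact: szego_bound.
Qed.

(** Evaluation by the reproducing kernel. It stands in for the limit in [disk_extension], with which
    it agrees on integrable functions, and turns point values into integrals. *)
Definition ev F a : R[i] := circle_integral (fun z => F z * conjc (szego a z)).

Lemma fourier_nat F (k : nat) :
  fourier F k%:Z = circle_integral (fun z => F z * conjc z ^+ k).
Proof.
apply: eq_circle_integral => z z1.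
by rewrite -exprnN -unit_inv// exprVn.
Qed.

(** Finite geometric series under the integral sign. The remainder carries the factor $(a\bar z)^n$,
    which on the circle has constant modulus $|a|^n$, so its decay is immediate. *)
Lemma fourier_partial_sum F a n : absc a < 1 -> CI F ->
  \sum_(0 <= k < n) fourier F k%:Z * a ^+ k =
  ev F a - circle_integral (fun z => F z * conjc (szego a z) * (a * conjc z) ^+ n).
Proof.
move=> a1 iF; have ik m : CI (fun z => F z * conjc (szego a z) * (a * conjc z) ^+ m).
  apply: eq_CI (CIZ (a ^+ m) (CI_unit_powJ m (CI_szegoJ a1 iF))) => z.
  by rewrite exprMn; ring.
elim: n => [|n ih].
  rewrite big_geq//; apply/esym/eqP; rewrite subr_eq0; apply/eqP.
  by apply: eq_circle_integral => z _; rewrite expr0 mulr1.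
rewrite big_nat_recr//= ih fourier_nat mulrC -circle_integralZ; last exact: CI_unit_powJ.
rewrite -addrA; congr (_ + _); apply/eqP; rewrite addrC subr_eq addrC -subr_eq.
rewrite opprK addrC -circle_integralD//; last first.
  by apply: CIZ; exact: CI_unit_powJ.
apply/eqP/eq_circle_integral => z z1.
have := szego_denJ_neq0 a1 z1 => h.
rewrite szegoJ exprS exprMn; by field.
Qed.

Lemma fourier_series_cvg F a : absc a < 1 -> CI F ->
  (fun n : nat => \sum_(0 <= k < n) fourier F k%:Z * a ^+ k : R[i]^o) @ \oo
  --> (ev F a : R[i]^o).
Proof.
move=> a1 iF; apply: cvg_absc.
pose C := cmean (fun z => absc (F z * conjc (szego a z))).
apply: (@squeeze_cvgr _ _ _ _ (fun=> 0) (fun n => C * absc a ^+ n)).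
- near=> n; rewrite absc_ge0/= fourier_partial_sum// opprB addrC subrK.
  have iK := CI_szegoJ a1 iF.
  have ik : CI (fun z => F z * conjc (szego a z) * (a * conjc z) ^+ n).
    apply: eq_CI (CIZ (a ^+ n) (CI_unit_powJ n iK)) => z.
    by rewrite exprMn; ring.
  apply: (le_trans (absc_circle_integral ik)); rewrite mulrC -cmeanZ; last exact: CI_absc.
  apply: cmean_le; [exact: CI_absc|exact/cintegrableZ/CI_absc|].
  apply: ae_circleW => z z1; rewrite [leLHS]abscM [leLHS]mulrC.
  by rewrite abscX abscM absc_conj z1 mulr1.
- exact: cvg_cst.
- rewrite -[X in _ --> X](mulr0 C); apply: cvgM; first exact: cvg_cst.
  by apply: cvg_expr; rewrite ger0_norm ?absc_ge0.
Unshelve. all: by end_near. Qed.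

Lemma disk_extensionE F a : absc a < 1 -> CI F -> disk_extension F a = ev F a.
Proof.
move=> a1 iF; apply: (@cvg_lim R[i]^o _ _ _ _ _ _ (fourier_series_cvg a1 iF)).
exact: norm_hausdorff.
Qed.

Lemma H2E F : H2 F <->
  L2 F /\ forall n, circle_integral (fun z => F z * z ^+ n.+1) = 0.
Proof.
have h n : fourier F (- (n.+1%:Z)) = circle_integral (fun z => F z * z ^+ n.+1).
  by rewrite /fourier opprK.
by split=> -[lF hF]; split => // n; rewrite ?h// -h.
Qed.

Lemma eq_H2 F G : F =1 G -> H2 F -> H2 G.
Proof. by move=> /funext->. Qed.

Lemma H2_L2 F : H2 F -> L2 F.
Proof. by case. Qed.

Lemma H2_horner F (p : {poly R[i]}) : H2 F -> H2 (fun z => F z * p.[z]).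
Proof.
move=> /H2E[lF hF]; apply/H2E; split; first exact: L2_horner.
have iF := L2_CI lF.
elim/poly_ind: p => [n|p c ih n].
  rewrite -[RHS](circle_integral_cst 0); apply: eq_circle_integral => z _.
  by rewrite horner0 mulr0 mul0r.
rewrite (@eq_circle_integral _ _ (fun z =>
  F z * p.[z] * z ^+ n.+2 + c * (F z * z ^+ n.+1))); last first.
  by move=> z z1; rewrite hornerMXaddC [z ^+ n.+2]exprS; ring.
rewrite circle_integralD.
- by rewrite circle_integralZ ?ih ?hF ?mulr0 ?addr0//; exact: CI_unit_pow.
- by apply: CI_unit_pow; exact: CI_horner.
- by apply: CIZ; exact: CI_unit_pow.
Qed.

Lemma H2Z c F : H2 F -> H2 (fun z => c * F z).
Proof.
move=> /(H2_horner c%:P); apply: eq_H2 => z.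
by rewrite hornerC mulrC.
Qed.

Lemma cisX (x : R) n : cis x ^+ n = cis (n%:R * x).
Proof.
elim: n => [|n ih]; first by rewrite expr0 mul0r /cis cos0 sin0.
rewrite exprS ih -nat1r mulrDl mul1r /cis cosD sinD.
by apply: complex_ext; rewrite ?cReM ?cImM//=; ring.
Qed.

Lemma integral_arc_derive (f F : R -> R) : continuous f ->
  (forall x, is_derive x (1 : R) F (f x)) -> F (2 * pi) = F 0 ->
  \int[lebesgue_measure]_(x in @Defs.arc R) f x = 0.
Proof.
move=> cf dF Fper; have cF : continuous F.
  move=> x; apply: differentiable_continuous; apply/derivable1_diffP.
  by have [] := dF x.
rewrite /Rintegral (@continuous_FTC2 _ f F).
- by rewrite Fper -EFinB subrr.
- by rewrite mulr_gt0// pi_gt0.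
- exact: continuous_subspaceT.
- split.
  + by move=> x _; have [] := dF x.
  + by apply: cvg_at_right_filter; exact: cF.
  + by apply: cvg_at_left_filter; exact: cF.
- by move=> x _; rewrite derive1E; have [] := dF x.
Qed.

Lemma circle_integral_pow n : circle_integral (fun z : R[i] => z ^+ n.+1) = 0.
Proof.
have n0 : n.+1%:R != 0 :> R by rewrite pnatr_eq0.
have cM : continuous (fun x : R => n.+1%:R * x).
  by move=> x; apply: cvgM; [exact: cvg_cst|exact: cvg_id].
have dM (x : R) : is_derive x (1 : R) (fun x : R => n.+1%:R * x) n.+1%:R.
  by apply: is_derive_eq; rewrite /GRing.scale/= mulr1.
have p0 : cis (n.+1%:R * (2 * pi)) = 1 :> R[i].
  rewrite -cisX [cis _](_ : _ = 1) ?expr1n//.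
  by rewrite /cis mulr_natl cos2pi sin2pi.
have hcos : \int[lebesgue_measure]_(x in @Defs.arc R) cos (n.+1%:R * x) = 0.
  apply: (@integral_arc_derive _ (fun x => n.+1%:R^-1 * sin (n.+1%:R * x))).
  - by move=> x; apply: cvg_comp; [exact: cM|exact: continuous_cos].
  - move=> x.
    have h := @is_derive1_comp _ sin _ _ _ _ (is_derive_sin (n.+1%:R * x)) (dM x).
    by apply: is_derive_eq; rewrite /GRing.scale/= mulrCA mulVf ?mulr1.
  - by have [_ ->] := p0; rewrite !mulr0 sin0 mulr0.
have hsin : \int[lebesgue_measure]_(x in @Defs.arc R) sin (n.+1%:R * x) = 0.
  apply: (@integral_arc_derive _ (fun x => - n.+1%:R^-1 * cos (n.+1%:R * x))).
  - by move=> x; apply: cvg_comp; [exact: cM|exact: continuous_sin].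
  - move=> x.
    have h := @is_derive1_comp _ cos _ _ _ _ (is_derive_cos (n.+1%:R * x)) (dM x).
    by apply: is_derive_eq; rewrite /GRing.scale/= mulNr mulNr mulrN opprK mulrCA
      mulVf ?mulr1.
  - by have [-> _] := p0; rewrite mulr0 cos0.
rewrite circle_integralE; apply: complex_ext => /=; rewrite /cmean.
- rewrite -[RHS](mulr0 (2 * pi)^-1) -[in RHS]hcos; congr (_ * _).
  by apply: eq_Rintegral => x _; rewrite cisX.
- rewrite -[RHS](mulr0 (2 * pi)^-1) -[in RHS]hsin; congr (_ * _).
  by apply: eq_Rintegral => x _; rewrite cisX.
Qed.

Lemma H2_cst c : H2 (fun=> c).
Proof.
apply/H2E; split; first exact: L2_cst.
move=> n; rewrite circle_integralZ ?circle_integral_pow ?mulr0//.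
by apply: eq_CI (CI_unit_pow n.+1 (L2_CI (L2_cst 1))) => z; rewrite mul1r.
Qed.

Lemma evZ c F a : absc a < 1 -> CI F -> ev (fun z => c * F z) a = c * ev F a.
Proof.
move=> a1 iF; rewrite /ev -circle_integralZ; last exact: CI_szegoJ.
by apply: eq_circle_integral => z _; rewrite mulrA.
Qed.

Lemma evB F G a : absc a < 1 -> CI F -> CI G ->
  ev (fun z => F z - G z) a = ev F a - ev G a.
Proof.
move=> a1 iF iG; rewrite /ev -circle_integralB; try exact: CI_szegoJ.
by apply: eq_circle_integral => z _; rewrite mulrBl.
Qed.

(* On the circle, (z - a) times the conjugate of the Szego kernel is z. *)
Lemma ev_mulX F a : absc a < 1 -> H2 F -> ev (fun z => F z * z) a = a * ev F a.
Proof.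
move=> a1 /H2E[lF hF]; have iF := L2_CI lF.
have iX : CI (fun z => F z * z) by apply: eq_CI (CI_unit_pow 1 iF).
apply/eqP; rewrite -subr_eq0 -evZ// -evB//; last exact: CIZ.
rewrite -(hF 0%N); apply/eqP/eq_circle_integral => z z1.
have := szego_denJ_neq0 a1 z1 => h; rewrite szegoJ expr1.
apply: (mulIf h); rewrite mulfVK//.
have := unit_conj z1 => h1.
rewrite -[in LHS](mul1r (a * F z)) -{1}h1; ring.
Qed.

Lemma ev_horner F (p : {poly R[i]}) a : absc a < 1 -> H2 F ->
  ev (fun z => F z * p.[z]) a = p.[a] * ev F a.
Proof.
move=> a1 hF; have iF := L2_CI (H2_L2 hF).
elim/poly_ind: p => [|p c ih].
  rewrite horner0 mul0r -[RHS](circle_integral_cst 0).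
  by apply: eq_circle_integral => z _; rewrite horner0 mulr0 mul0r.
have iFp := CI_horner p iF.
rewrite (_ : (fun z => _) = (fun z => (F z * p.[z]) * z - (- c) * F z)); last first.
  by apply/funext => z; rewrite hornerMXaddC; ring.
rewrite evB//; last 2 first.
  by apply: eq_CI (CI_unit_pow 1 iFp).
  exact: CIZ.
rewrite evZ// ev_mulX//; last exact: H2_horner.
by rewrite ih hornerMXaddC; ring.
Qed.

(** After conjugation the left side is [ev] of the conjugate of [F], whose power series has only its
    constant term because [F] lies in [H2]. *)
Lemma mean_szego F a : absc a < 1 -> H2 F ->
  circle_integral (fun z => F z * szego a z) = circle_integral F.
Proof.
move=> a1 /H2E[lF hF]; have iF := L2_CI lF; have iJ := CIJ iF.
apply: (can_inj (@conjcK R)); rewrite -!circle_integralJ//; last exact: CI_szego.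
rewrite (@eq_circle_integral _ _ (fun z => conjc (F z) * conjc (szego a z))); last first.
  by move=> z _; rewrite rmorphM.
have h : (circle_integral (fun z => conjc (F z)) : R[i]^o) @[n --> \oo] -->
    (ev (fun z => conjc (F z)) a : R[i]^o).
  apply: cvg_trans (fourier_series_cvg a1 iJ); apply: near_eq_cvg.
  near=> n; have n0 : (0 < n)%N by near: n; exact: nbhs_infty_gt.
  rewrite -(prednK n0) big_nat_recl//= expr0 mulr1 fourier_nat.
  rewrite big1_seq ?addr0 => [|k _].
    by apply: eq_circle_integral => z _; rewrite expr0 mulr1.
  rewrite fourier_nat (@eq_circle_integral _ _ (fun z => conjc (F z * z ^+ k.+1))).
    by rewrite circle_integralJ ?hF ?rmorph0 ?mul0r//; exact: CI_unit_pow.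
  by move=> z _; rewrite rmorphM rmorphXn.
apply/esym; apply: cvg_unique h; first exact: norm_hausdorff.
exact: cvg_cst.
Unshelve. all: by end_near. Qed.

End Evaluation.

(** * Completeness *)

Section RieszFischer.
Variable R : realType.
Implicit Types (F G : R[i] -> R[i]) (u v : R[i] -> R) (c : R[i]).
Local Notation mu := (@lebesgue_measure R).

(* x_n + 2 c / 2^n decreases and x_n - 2 c / 2^n increases to the same limit. *)
Lemma geometric_cauchy_lim (x : nat -> R) (c : R) :
  (forall n, `|x n.+1 - x n| <= c * 2^-1 ^+ n) ->
  x @ \oo --> limn x /\ forall n, `|limn x - x n| <= 2 * c * 2^-1 ^+ n.
Proof.
move=> hx.
have c0 : 0 <= c by have := hx 0%N; rewrite expr0 mulr1; exact: le_trans.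
pose g n : R := 2 * c * 2^-1 ^+ n.
have gS n : g n = g n.+1 + c * 2^-1 ^+ n by rewrite /g exprS; field.
have g0 n : 0 <= g n by rewrite /g !mulr_ge0// exprn_ge0.
have gcv : g @ \oo --> (0 : R).
  rewrite -[X in _ --> X](mulr0 (2 * c)); apply: cvgM; first exact: cvg_cst.
  by apply: cvg_expr; rewrite ger0_norm ?invf_lt1// ltr1n.
pose y n := x n + g n; pose w n := x n - g n.
have yd : {homo y : n m / (n <= m)%N >-> m <= n}.
  apply/nonincreasing_seqP => n; rewrite /y (gS n).
  by have := hx n; rewrite ler_norml => /andP[_]; lra.
have wi : {homo w : n m / (n <= m)%N >-> n <= m}.
  apply/nondecreasing_seqP => n; rewrite /w (gS n).
  by have := hx n; rewrite ler_norml => /andP[+ _]; lra.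
have wy n : w 0%N <= y n.
  by rewrite (le_trans (wi 0%N n _))// /w /y; have := g0 n; lra.
have ycv : cvgn y.
  by apply: nonincreasing_is_cvgn => //; exists (w 0%N) => _ [n _ <-].
have xcv : x @ \oo --> limn y.
  rewrite (_ : x = (fun n => y n - g n)); last by apply/funext => n; rewrite /y addrK.
  by rewrite -[X in _ --> X]subr0; exact: cvgB.
have xl : limn x = limn y by apply: cvg_lim.
have wcv : w @ \oo --> limn y by rewrite -[X in _ --> X]subr0; exact: cvgB.
split; first by rewrite xl.
move=> n; rewrite xl -/(g n) ler_norml; apply/andP; split.
- have := nondecreasing_cvgn_le wi (cvgP _ wcv) n; rewrite (cvg_lim _ wcv)//.
  by rewrite /w; lra.
- by have := nonincreasing_cvgn_ge yd ycv n; rewrite /y; lra.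
Qed.

(** Where [S] is infinite the sequence need not converge, and the limit is replaced by 0. The set
    where [S] is finite is measurable, which keeps the patched limit measurable. *)
Lemma geometric_cauchy_measurable (u_ : nat -> R[i] -> R) (S : R[i] -> \bar R) :
  (forall n, cmeas (u_ n)) ->
  measurable_fun (@Defs.arc R : set (measurableTypeR R)) (S \o @cis R) ->
  (forall z n, S z \is a fin_num ->
    `|u_ n.+1 z - u_ n z| <= Num.sqrt (fine (S z)) * 2^-1 ^+ n) ->
  exists2 u, cmeas u & forall z n, S z \is a fin_num ->
    `|u z - u_ n z| <= 2 * Num.sqrt (fine (S z)) * 2^-1 ^+ n.
Proof.
move=> mu_ mS hS.
pose u z := if S z \is a fin_num then limn (fun n => u_ n z) else 0.
exists u; last first.
  by move=> z n Sz; rewrite /u Sz; have [_] := geometric_cauchy_lim (hS z ^~ Sz).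
pose D := @Defs.arc R `&` [set x | (S \o @cis R) x \is a fin_num].
have mD : measurable (D : set (measurableTypeR R)).
  exact: (emeasurable_fin_num (@measurable_arc R) mS).
pose l x := limn (fun n => u_ n (cis x)).
have ml : measurable_fun (D : set (measurableTypeR R)) (l : R -> R).
  apply: (@measurable_fun_cvg _ _ _ _ (fun n x => u_ n (cis x))).
    move=> n; apply: (measurable_funS _ _ (mu_ n)); first exact: measurable_arc.
    by move=> x [].
  move=> x [_ Sx]; have [] := geometric_cauchy_lim (hS (cis x) ^~ Sx); exact.
have : measurable_fun (@Defs.arc R : set (measurableTypeR R)) (l \_ D).
  apply/measurable_restrict => //.
  by apply: (measurable_funS mD _ ml) => x [].
apply: eq_measurable_fun => x; rewrite inE => ax; rewrite /u /= patchE.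
by case: ifPn => [|/negP]; rewrite inE /D/= => h; case: ifPn => // Sx;
  [case: h => _ /negPn; rewrite Sx|exfalso; apply: h; split].
Qed.

(** The rate $8^{-n}$ makes $\sum_k 4^k |F_{k+1}-F_k|^2$ integrable, and where this sum is a finite
    $s$ the increments are at most $\sqrt s\, 2^{-n}$. The conclusion is a pointwise majorant
    because it yields convergence almost everywhere and, once integrated, convergence in norm. *)
Lemma riesz_fischer (F_ : nat -> R[i] -> R[i]) : (forall n, L2 (F_ n)) ->
  (forall n, nrm2 (fun z => F_ n.+1 z - F_ n z) <= 8^-1 ^+ n) ->
  exists F S, [/\ circle_measurable F, cintegrable S &
    ae_circle (fun z => forall n, absc (F z - F_ n z) ^+ 2 <= S z * 4^-1 ^+ n)].
Proof.
move=> lF_ hF.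
have lD n : L2 (fun z => F_ n.+1 z - F_ n z) by exact: L2B.
pose a k z := 4 ^+ k * absc (F_ k.+1 z - F_ k z) ^+ 2.
have a0 k z : 0 <= a k z by rewrite /a mulr_ge0 ?exprn_ge0 ?absc_ge0.
have ia k : cintegrable (a k) by apply: cintegrableZ; exact: L2_absc2.
pose S z : \bar R := (\sum_(0 <= k <oo) (a k z)%:E)%E.
have S0 z : (0 <= S z)%E by apply: nneseries_ge0 => n _ _; rewrite lee_fin.
have mS : measurable_fun (@Defs.arc R : set (measurableTypeR R)) (S \o @cis R).
  apply: (@ge0_emeasurable_sum _ _ _ _ (fun k x => (a k (cis x))%:E) xpredT).
    by move=> k x _ _; rewrite lee_fin.
  by move=> k _; exact: (measurable_int _ (ia k)).
have iS : mu.-integrable (@Defs.arc R : set (measurableTypeR R)) (S \o @cis R).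
  apply/integrableP; split => //.
  under eq_integral do rewrite gee0_abs//=.
  rewrite integral_nneseries//; last 2 first.
    by move=> k; exact: (measurable_int _ (ia k)).
    by move=> k x _; rewrite lee_fin.
  have tp : 0 < 2 * pi :> R by rewrite mulr_gt0// pi_gt0.
  have h k : (\int[mu]_(x in @Defs.arc R) (a k (cis x))%:E <=
      (2 * (2 * pi) / (2 ^ (k + 1))%:R)%:E)%E.
    rewrite -[leLHS](fineK (integrable_fin_num (@measurable_arc R) (ia k))) lee_fin.
    have -> : fine (\int[mu]_(x in @Defs.arc R) (EFin \o (a k \o @cis R)) x)%E =
        (2 * pi) * cmean (a k).
      by rewrite /cmean mulrA mulfV ?gt_eqF// mul1r.
    rewrite cmeanZ; last exact: L2_absc2.
    have := hF k; rewrite /nrm2 => hk.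
    have -> : 2 * (2 * pi) / (2 ^ (k + 1))%:R = (2 * pi) * 2^-1 ^+ k :> R.
      by rewrite addn1 expnS natrM natrX exprVn; field.
    rewrite ler_pM2l// (_ : 2^-1 = 4 * 8^-1); last by field.
    by rewrite exprMn ler_wpM2l// exprn_ge0.
  apply: (@le_lt_trans _ _ (2 * (2 * pi))%:E); last exact: ltry.
  have := @cvg_geometric_eseries_half R (2 * (2 * pi)) 0%N.
  rewrite expr0 divr1 => /cvg_lim <-//; apply: lee_nneseries.
  - by move=> k _ _; apply: integral_ge0 => x _; rewrite lee_fin.
  - by move=> k _; exact: h.
pose s z := fine (S z).
have is' : cintegrable s.
  apply: le_integrable iS => //.
    apply/measurable_EFinP; apply: (measurableT_comp _ mS).
    exact: fine_measurable.
  move=> x _; rewrite /s /=; case: (S _) => [r||] //=; exact: leey.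
have aeS : ae_circle (fun z => S z \is a fin_num).
  exact: (integrable_ae (@measurable_arc R) iS).
have step_le z n : S z \is a fin_num ->
    absc (F_ n.+1 z - F_ n z) <= Num.sqrt (s z) * 2^-1 ^+ n.
  move=> Sz; have an : a n z <= s z.
    rewrite -lee_fin /s fineK//.
    apply: (@le_trans _ _ (\sum_(0 <= k < n.+1) (a k z)%:E)%E).
      rewrite big_nat_recr//= leeDr// sume_ge0// => k _; by rewrite lee_fin.
    by apply: nneseries_lim_ge => k _ _; rewrite lee_fin.
  rewrite -(@ler_pXn2r _ 2) ?nnegrE ?absc_ge0 ?mulr_ge0 ?sqrtr_ge0 ?exprn_ge0//.
  have s0 : 0 <= s z by rewrite fine_ge0.
  rewrite exprMn sqr_sqrtr// exprAC (_ : 2^-1 ^+ 2 = 4^-1); last by field.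
  by rewrite exprVn ler_pdivlMr ?exprn_gt0// mulrC.
have stepR z n : S z \is a fin_num ->
    `|complex.Re (F_ n.+1 z) - complex.Re (F_ n z)| <= Num.sqrt (s z) * 2^-1 ^+ n.
  by move=> Sz; rewrite -cReN -cReD (le_trans (normRe_absc _))// step_le.
have stepI z n : S z \is a fin_num ->
    `|complex.Im (F_ n.+1 z) - complex.Im (F_ n z)| <= Num.sqrt (s z) * 2^-1 ^+ n.
  by move=> Sz; rewrite -cImN -cImD (le_trans (normIm_absc _))// step_le.
have [uR mR hR] := @geometric_cauchy_measurable (fun n z => complex.Re (F_ n z)) S
  (fun n => (L2_meas (lF_ n)).1) mS stepR.
have [uI mI hI] := @geometric_cauchy_measurable (fun n z => complex.Im (F_ n z)) S
  (fun n => (L2_meas (lF_ n)).2) mS stepI.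
(* The factor 8 is 4 for the real part plus 4 for the imaginary part. *)
exists (fun z => uR z +i* uI z), (fun z => 8 * s z); split => //.
- exact: cintegrableZ.
- apply: ae_circleS aeS => z _ Sz n.
  have s0 : 0 <= s z by rewrite fine_ge0.
  have sq t : `|t| <= 2 * Num.sqrt (s z) * 2^-1 ^+ n -> t ^+ 2 <= 4 * s z * 4^-1 ^+ n.
    move=> ht; rewrite -(@real_normK _ t) ?num_real//.
    have -> : 4 * s z * 4^-1 ^+ n = (2 * Num.sqrt (s z) * 2^-1 ^+ n) ^+ 2.
      rewrite !exprMn sqr_sqrtr// [2^-1 ^+ n ^+ 2]exprAC.
      by rewrite (_ : 2^-1 ^+ 2 = 4^-1 :> R); [congr (_ * _ * _); ring|field].
    by rewrite lerXn2r ?nnegrE// !mulr_ge0 ?sqrtr_ge0 ?exprn_ge0.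
  rewrite absc_sqr cReD cImD cReN cImN/=.
  have := sq _ (hR z n Sz); have := sq _ (hI z n Sz); lra.
Qed.

End RieszFischer.

(** * Szego's factorization *)

Section SzegoFactorization.
Variable R : realType.
Implicit Types (F G : R[i] -> R[i]) (u v w : R[i] -> R) (c : R[i]) (p q : {poly R[i]}).

Lemma conjc_mulJ (x y : R[i]) : conjc (x * conjc y) = conjc x * y.
Proof. by apply: complex_ext; rewrite !(cReM, cImM, cReJ, cImJ); ring. Qed.

Lemma eq_nrm2 F G : (forall z, absc z = 1 -> F z = G z) -> nrm2 F = nrm2 G.
Proof. by move=> FG; apply: eq_cmean => z z1; rewrite FG. Qed.

Lemma nrm2Z c F : L2 F -> nrm2 (fun z => c * F z) = absc c ^+ 2 * nrm2 F.
Proof.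
move=> lF; rewrite /nrm2 -cmeanZ; last exact: L2_absc2.
by apply: eq_cmean => z _; rewrite abscM exprMn.
Qed.

Lemma nrm2D F G : L2 F -> L2 G -> nrm2 (fun z => F z + G z) =
  nrm2 F + 2 * complex.Re (circle_integral (fun z => F z * conjc (G z))) + nrm2 G.
Proof.
move=> lF lG; have [iR _] := L2_CI_mul lF (L2J lG).
have iF := L2_absc2 lF; have iG := L2_absc2 lG.
rewrite circle_integralE/= /nrm2 -cmeanZ// -cmeanD//; last exact: cintegrableZ.
rewrite -cmeanD//; last by apply: cintegrableD => //; exact: cintegrableZ.
apply: eq_cmean => z _; rewrite !absc_sqr cReD cImD cReM cReJ cImJ; ring.
Qed.

Lemma nrm2_parallelogram F G : L2 F -> L2 G ->
  nrm2 (fun z => F z - G z) = 2 * nrm2 F + 2 * nrm2 G - nrm2 (fun z => F z + G z).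
Proof.
move=> lF lG; have lN := L2Z (- 1) lG.
have -> : nrm2 (fun z => F z - G z) = nrm2 (fun z => F z + (- 1) * G z).
  by apply: eq_nrm2 => z _; rewrite mulN1r.
rewrite !nrm2D// nrm2Z// abscN absc1 expr1n mul1r.
have -> : circle_integral (fun z => F z * conjc (- 1 * G z)) =
    - circle_integral (fun z => F z * conjc (G z)).
  rewrite -circle_integralN; last exact/L2_CI_mul/L2J.
  by apply: eq_circle_integral => z _; rewrite mulN1r rmorphN mulrN.
rewrite cReN; ring.
Qed.

Lemma nrm2_le2 F G : L2 F -> L2 G -> nrm2 F <= 2 * nrm2 G + 2 * nrm2 (fun z => G z - F z).
Proof.
move=> lF lG; have lB := L2B lG lF.
have iF := L2_absc2 lF; have iG := L2_absc2 lG; have iB := L2_absc2 lB.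
rewrite /nrm2 -!cmeanZ// -cmeanD; try exact: cintegrableZ.
apply: cmean_le => //; first by apply: cintegrableD; exact: cintegrableZ.
apply: ae_circleW => z _; have := absc_sqrD (G z) (F z - G z).
by rewrite subrKC [absc (G z - _)]abscB.
Qed.

(** Takes the place of passages to the limit: a quantity is shown to vanish by bounding its square
    along the approximating polynomials. *)
Lemma geometric_le0 (x K : R) : 0 <= x -> (forall n, x <= K * 4^-1 ^+ n) -> x = 0.
Proof.
move=> x0 xK; apply/eqP; rewrite eq_le x0 andbT.
have h : (K * 4^-1 ^+ n @[n --> \oo] --> (0 : R)).
  rewrite -[X in _ --> X](mulr0 K); apply: cvgM; first exact: cvg_cst.
  by apply: cvg_expr; rewrite ger0_norm ?invf_lt1// ltr1n.
rewrite -(cvg_lim (@Rhausdorff R) h); apply: limr_ge; first exact: cvgP h.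
by near=> n; exact: xK.
Unshelve. all: by end_near. Qed.

(** Multiplication by $\sqrt w$ is an isometry from $L^2(w)$ to $L^2$, so that the weighted problem
    is posed in the unweighted space. *)
Definition wpoly w p (z : R[i]) : R[i] := p.[z] * (Num.sqrt (w z))%:C.

Lemma L2_sqrt w : (forall z, 0 <= w z) -> cintegrable w ->
  L2 (fun z => (Num.sqrt (w z))%:C).
Proof.
move=> w0 iw; apply: (L2_le _ iw).
  by apply: circle_measurable_real; apply: cmeas_sqrt; exact: cintegrable_meas.
by apply: ae_circleW => z _; rewrite absc_real real_normK ?num_real// sqr_sqrtr.
Qed.

Lemma L2_wpoly w p : (forall z, 0 <= w z) -> cintegrable w -> L2 (wpoly w p).
Proof.
move=> w0 iw; apply: eq_L2 (L2_horner p (L2_sqrt w0 iw)) => z.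
by rewrite mulrC.
Qed.

(* Szego's extremal problem: minimise the weighted norm over polynomials with
   value 1 at 0.  The minimiser v / sqrt w is orthogonal to z^k v / sqrt w for
   k > 0, so that |v|^2 has vanishing nonconstant Fourier coefficients. *)
Lemma szego_factor w (eps : R) : (forall z, 0 <= w z) -> cintegrable w -> 0 < eps ->
  (forall p, p.[0] = 1 -> eps <= nrm2 (wpoly w p)) ->
  exists (v : R[i] -> R[i]) (c K : R) (p_ : nat -> {poly R[i]}),
   [/\ L2 v, 0 < c, ae_circle (fun z => absc (v z) ^+ 2 = c),
       ae_circle (fun z => 0 < w z) &
       (forall n, nrm2 (fun z => v z - wpoly w (p_ n) z) <= K * 4^-1 ^+ n) /\
       H2 (fun z => conjc (v z) * (Num.sqrt (w z))%:C)].
Proof.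
move=> w0 iw e0 hw.
have lw p : L2 (wpoly w p) by exact: L2_wpoly.
have wD p q z : wpoly w (p + q) z = wpoly w p z + wpoly w q z.
  by rewrite /wpoly hornerD mulrDl.
have wZ c p z : wpoly w (c *: p) z = c * wpoly w p z.
  by rewrite /wpoly hornerZ mulrA.
pose E := [set nrm2 (wpoly w p) | p in [set p | p.[0] = 1]].
have E0 : E !=set0 by exists (nrm2 (wpoly w 1)), 1 => //=; rewrite hornerC.
have Elb : has_lbound E by exists eps => _ [p p0 <-]; exact: hw.
pose m := inf E.
have mE p : p.[0] = 1 -> m <= nrm2 (wpoly w p).
  by move=> p0; apply: ge_inf => //; exists p.
(* The excess is fitted to the parallelogram law: the midpoint of two admissible polynomials is
   admissible, so consecutive near-minimisers have squared distance at most twice the sum of their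
   excesses, hence at most $8^{-n}$. *)
have hp n : exists p, p.[0] = 1 /\ nrm2 (wpoly w p) < m + 8^-1 ^+ n / 4.
  have d0 : 0 < 8^-1 ^+ n / 4 :> R by rewrite divr_gt0// exprn_gt0.
  by have [_ [p p0 <-] h] := inf_adherent d0 (conj E0 Elb); exists p.
have [p_ hp_] := choice hp.
have p0 n : (p_ n).[0] = 1 by have [] := hp_ n.
have pm n : nrm2 (wpoly w (p_ n)) < m + 8^-1 ^+ n / 4 by have [] := hp_ n.
have hF n : nrm2 (fun z => wpoly w (p_ n.+1) z - wpoly w (p_ n) z) <= 8^-1 ^+ n.
  rewrite nrm2_parallelogram//.
  have -> : nrm2 (fun z => wpoly w (p_ n.+1) z + wpoly w (p_ n) z) =
      4 * nrm2 (wpoly w (2^-1 *: (p_ n.+1 + p_ n))).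
    rewrite (_ : nrm2 (wpoly w _) = nrm2 (fun z => 2^-1 *
      (wpoly w (p_ n.+1) z + wpoly w (p_ n) z))); last first.
      by apply: eq_nrm2 => z _; rewrite wZ wD.
    rewrite nrm2Z; last exact: L2D.
    rewrite abscV (_ : absc 2 = 2).
      by rewrite mulrA (_ : 4 * 2^-1 ^+ 2 = 1) ?mul1r//; field.
    by rewrite -[2](rmorph_nat (real_complex R)) absc_real ger0_norm.
  have mm : m <= nrm2 (wpoly w (2^-1 *: (p_ n.+1 + p_ n))).
    by apply: mE; rewrite hornerZ hornerD !p0; field.
  have := pm n; have := pm n.+1.
  have : 8^-1 ^+ n.+1 <= 8^-1 ^+ n :> R.
    by rewrite exprS ler_piMl ?exprn_ge0// invf_le1// ler1n.
  lra.
have [v [S [mv iS aeS]]] := riesz_fischer (fun n => lw (p_ n)) hF.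
have lvB n : L2 (fun z => v z - wpoly w (p_ n) z).
  apply: (L2_le (circle_measurableB mv (L2_meas (lw _)))
    (cintegrableZ (4^-1 ^+ n) iS)).
  by apply: ae_circleS aeS => z _ /(_ n); rewrite mulrC.
have lv : L2 v.
  by apply: eq_L2 (L2D (lvB 0%N) (lw (p_ 0%N))) => z; rewrite subrK.
pose K := cmean S.
have vK n : nrm2 (fun z => v z - wpoly w (p_ n) z) <= K * 4^-1 ^+ n.
  rewrite mulrC -cmeanZ//; apply: cmean_le.
  - exact: L2_absc2.
  - exact: cintegrableZ.
  - by apply: ae_circleS aeS => z _ /(_ n); rewrite mulrC.
have K0 : 0 <= K by have := vK 0%N; rewrite expr0 mulr1; apply: le_trans; exact: nrm2_ge0.
have q4 n : 0 <= 4^-1 ^+ n :> R by rewrite exprn_ge0.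
have q84 n : 8^-1 ^+ n <= 4^-1 ^+ n :> R.
  by rewrite lerXn2r ?nnegrE// lef_pV2 ?posrE// ler_nat.
have orth q : q.[0] = 0 ->
    circle_integral (fun z => v z * conjc (wpoly w q z)) = 0.
  move=> q0; set N := nrm2 (wpoly w q); have N0 : 0 <= N := nrm2_ge0 _.
  set I := circle_integral _.
  pose In n := circle_integral (fun z => wpoly w (p_ n) z * conjc (wpoly w q z)).
  have hIn n : absc (In n) ^+ 2 <= (8^-1 ^+ n / 4) * (N + 1).
    (* Variation of the near-minimiser: [p_ n + t *: q] is still admissible, and this [t] lowers the
       norm by at least [s * absc (In n) ^+ 2], which cannot exceed the excess. With [N + 1] in
       place of [N] the case [N = 0] needs no separate treatment. *)
    pose s := (N + 1)^-1; pose t : R[i] := - (s%:C * In n).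
    have s0 : 0 < s by rewrite invr_gt0 ltr_wpDl.
    have := mE (p_ n + t *: q); rewrite hornerD hornerZ p0 q0 mulr0 addr0.
    move=> /(_ erefl).
    rewrite (@eq_nrm2 _ (fun z => wpoly w (p_ n) z + t * wpoly w q z)); last first.
      by move=> z _; rewrite wD wZ.
    rewrite nrm2D ?nrm2Z//; last exact: L2Z.
    have -> : circle_integral (fun z => wpoly w (p_ n) z * conjc (t * wpoly w q z))
        = conjc t * In n.
      rewrite /In -circle_integralZ; last exact/L2_CI_mul/L2J.
      by apply: eq_circle_integral => z _; rewrite rmorphM mulrCA.
    have -> : conjc t * In n = (- (s * absc (In n) ^+ 2))%:C.
      have cs : conjc s%:C = s%:C := conjc_real s.
      rewrite /t rmorphN rmorphM [X in - (X * _)]cs mulNr -mulrA.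
      by rewrite [conjc (In n) * _]mulrC mulc_conj -rmorphM -rmorphN.
    rewrite cReC /t abscN abscM absc_real exprMn real_normK ?num_real// -/N.
    have h2 : s ^+ 2 * absc (In n) ^+ 2 * N <= s * absc (In n) ^+ 2.
      have -> : s ^+ 2 * absc (In n) ^+ 2 * N = (s * absc (In n) ^+ 2) * (s * N) by ring.
      have sN : N * s <= 1 by rewrite ler_pdivrMr ?ltr_wpDl// mul1r lerDl.
      apply: ler_piMr; last by rewrite mulrC.
      by apply: mulr_ge0; [exact: ltW|exact: sqr_ge0].
    move=> h4; have h3 := pm n; rewrite -ler_pdivrMr ?ltr_wpDl// -/s; lra.
  have hI n : absc (I - In n) ^+ 2 <= K * 4^-1 ^+ n * N.
    rewrite /I /In -circle_integralB; try exact/L2_CI_mul/L2J.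
    rewrite (@eq_circle_integral _ _ (fun z =>
      (v z - wpoly w (p_ n) z) * conjc (wpoly w q z))); last first.
      by move=> z _; rewrite mulrBl.
    apply: (le_trans (cauchy_schwarz (lvB n) (L2J (lw q)))).
    rewrite (_ : nrm2 (fun z => conjc _) = N); first by rewrite ler_wpM2r.
    by apply: eq_cmean => z _; rewrite absc_conj.
  apply/eqP; rewrite -absc_eq0 -sqrf_eq0; apply/eqP.
  apply: (@geometric_le0 _ (2 * (K * N) + 2 * (N + 1))); first exact: sqr_ge0.
  move=> n; have := absc_sqrD (I - In n) (In n); rewrite subrK.
  have := hIn n; have := hI n; have := q84 n; have := q4 n.
  have N1 : 0 <= N + 1 by lra.
  set A := absc I ^+ 2; set B := absc (I - In n) ^+ 2; set D := absc (In n) ^+ 2.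
  set x := 4^-1 ^+ n; set y := 8^-1 ^+ n => x0 yx h1 h2 h3.
  have : y / 4 * (N + 1) <= x * (N + 1) by rewrite ler_wpM2r//; lra.
  lra.
have wX k p z : wpoly w ('X^k * p) z = z ^+ k * wpoly w p z.
  by rewrite /wpoly hornerM hornerXn mulrA.
(* ['X^k.+1 * p_ n] vanishes at 0, so [v] is orthogonal to its weighted version. Subtracting this
   zero leaves an integral with the factor [v - wpoly w (p_ n)], which is geometrically small. *)
have vz k : circle_integral (fun z => ((absc (v z) ^+ 2)%:C) * z ^+ k.+1) = 0.
  have lJ : L2 (fun z => conjc (v z) * z ^+ k.+1).
    have h : L2 (fun z => conjc (v z) * ('X^(k.+1) : {poly R[i]}).[z]).
      by apply: L2_horner; exact: L2J.
    have e : (fun z => conjc (v z) * ('X^(k.+1) : {poly R[i]}).[z]) =1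
             (fun z => conjc (v z) * z ^+ k.+1) by move=> z; rewrite hornerXn.
    exact: (eq_L2 e h).
  set I := circle_integral _.
  have hI n : absc I ^+ 2 <=
      K * 4^-1 ^+ n * nrm2 (fun z => conjc (v z) * z ^+ k.+1).
    have -> : I = circle_integral (fun z => (v z - wpoly w (p_ n) z) *
        (conjc (v z) * z ^+ k.+1)).
      have q0 : ('X^(k.+1) * p_ n).[0] = 0.
        by rewrite hornerM hornerXn expr0n/= mul0r.
      have := congr1 (@conjc R) (orth _ q0); rewrite rmorph0 -circle_integralJ; last first.
        exact/L2_CI_mul/L2J.
      move=> h; rewrite -[I]subr0 -h /I -circle_integralB.
      - apply: eq_circle_integral => z _; rewrite conjc_mulJ wX -mulc_conj; ring.
      - apply: CI_unit_pow; apply: CI_real; exact: L2_absc2.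
      - exact/CIJ/L2_CI_mul/L2J.
    apply: (le_trans (cauchy_schwarz (lvB n) lJ)).
    by rewrite ler_wpM2r ?nrm2_ge0.
  apply/eqP; rewrite -absc_eq0 -sqrf_eq0; apply/eqP.
  apply: (@geometric_le0 _ (K * nrm2 (fun z => conjc (v z) * z ^+ k.+1))).
    exact: sqr_ge0.
  by move=> n; rewrite mulrAC.
pose c := nrm2 v.
have iv := L2_absc2 lv.
have vc : ae_circle (fun z => absc (v z) ^+ 2 = c).
  have : ae_circle (fun z => absc (v z) ^+ 2 - c = 0).
    apply: fourier_uniqueness; first by apply: cintegrableB => //; exact: cintegrable_cst.
    case=> [|k].
      rewrite (@eq_circle_integral _ _ (fun z => (absc (v z) ^+ 2 - c)%:C)); last first.
        by move=> z _; rewrite expr0 mulr1.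
      rewrite circle_integral_real cmeanB ?cmean_cst ?subrr//.
      exact: cintegrable_cst.
    rewrite (@eq_circle_integral _ _ (fun z => (absc (v z) ^+ 2)%:C * z ^+ k.+1 -
      c%:C * z ^+ k.+1)); last by move=> z _; rewrite rmorphB mulrBl.
    rewrite circle_integralB.
    - rewrite vz circle_integralZ ?circle_integral_pow ?mulr0 ?subr0//.
      by apply: eq_CI (CI_unit_pow k.+1 (L2_CI (L2_cst 1))) => z; rewrite mul1r.
    - by apply: CI_unit_pow; exact: CI_real.
    - by apply: CI_unit_pow; exact: (L2_CI (L2_cst _)).
  by apply: ae_circleS => z _ /eqP; rewrite subr_eq0 => /eqP.
have c0 : 0 < c.
  rewrite lt_def nrm2_ge0 andbT; apply/eqP => c00.
  have : eps = 0.
    apply: (@geometric_le0 _ (2 * K)); first exact: ltW.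
    move=> n; apply: (le_trans (hw _ (p0 n))).
    have := nrm2_le2 (lw (p_ n)) lv; rewrite -/c c00.
    have := vK n; lra.
  by move/eqP; rewrite gt_eqF.
exists v, c, K, p_; split => //.
(* At a zero of [w] every [wpoly w (p_ n)] vanishes, so the pointwise limit [v] would vanish too,
   against $|v|^2 = c > 0$. *)
- apply: ae_circle2 vc aeS => z _ vc aeS.
  rewrite lt_def w0 andbT; apply/eqP => wz.
  have : absc (v z) ^+ 2 = 0.
    apply: (@geometric_le0 _ (S z)); first exact: sqr_ge0.
    by move=> n; have := aeS n; rewrite /wpoly wz sqrtr0 mulr0 subr0.
  by rewrite vc => /eqP; rewrite gt_eqF.
- split => //; apply/H2E; split.
    apply: (L2_le _ (cintegrableZ c iw)).
      by apply: circle_measurableM; [exact: circle_measurableJ|exact/L2_meas/L2_sqrt].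
    apply: ae_circleS vc => z _ vc.
    rewrite abscM exprMn absc_conj vc absc_real real_normK ?num_real//.
    by rewrite sqr_sqrtr.
  move=> n; have q0 : ('X^(n.+1) : {poly R[i]}).[0] = 0.
    by rewrite hornerXn expr0n.
  have := congr1 (@conjc R) (orth _ q0); rewrite rmorph0 -circle_integralJ; last first.
    exact/L2_CI_mul/L2J.
  move=> <-; apply: eq_circle_integral => z _.
  by rewrite conjc_mulJ /wpoly hornerXn; ring.
Qed.

End SzegoFactorization.

(** * From eigenvectors to dipoles *)

Section Nonvanishing.
Variable R : realType.
Implicit Types (F G : R[i] -> R[i]) (p : {poly R[i]}).

Lemma ev0 F : ev F 0 = circle_integral F.
Proof.
apply: eq_circle_integral => z _.
by rewrite szegoJ mul0r subr0 invr1 mulr1.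
Qed.

Lemma fourier_uniqueness_Re F : CI F ->
  (forall n, circle_integral (fun z => F z * z ^+ n) = 0) ->
  (forall n, circle_integral (fun z => F z * conjc z ^+ n) = 0) ->
  ae_circle (fun z => complex.Re (F z) = 0).
Proof.
move=> iF h1 h2; apply: fourier_uniqueness => [|n]; first by case: iF.
rewrite (@eq_circle_integral _ _ (fun z => 2^-1 *
   (F z * z ^+ n + conjc (F z * conjc z ^+ n)))); last first.
  by move=> z _; rewrite ReJ_add rmorphM rmorphXn/= conjcK; field.
have i1 := CI_unit_pow n iF; have i2 := CI_unit_powJ n iF.
rewrite circle_integralZ; last by apply: CID => //; exact: CIJ.
rewrite circle_integralD ?circle_integralJ ?h1 ?h2 ?rmorph0 ?addr0 ?mulr0//.
exact: CIJ.
Qed.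

Lemma fourier_uniqueness_complex F : CI F ->
  (forall n, circle_integral (fun z => F z * z ^+ n) = 0) ->
  (forall n, circle_integral (fun z => F z * conjc z ^+ n) = 0) ->
  ae_circle (fun z => F z = 0).
Proof.
move=> iF h1 h2; have hR := fourier_uniqueness_Re iF h1 h2.
have hI : ae_circle (fun z => complex.Re (- 'i%C * F z) = 0).
  apply: fourier_uniqueness_Re; first exact: CIZ.
  - move=> n; rewrite (@eq_circle_integral _ _ (fun z => - 'i%C * (F z * z ^+ n))).
      by rewrite circle_integralZ ?h1 ?mulr0//; exact: CI_unit_pow.
    by move=> z _; rewrite mulrA.
  - move=> n; rewrite (@eq_circle_integral _ _ (fun z => - 'i%C * (F z * conjc z ^+ n))).
      by rewrite circle_integralZ ?h2 ?mulr0//; exact: CI_unit_powJ.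
    by move=> z _; rewrite mulrA.
apply: ae_circle2 hR hI => z _ hR hI; apply: complex_ext => //.
by move: hI; rewrite cReM cReN cImN/= oppr0 mul0r sub0r mulN1r opprK.
Qed.

(* Divide by the lowest power of z; the quotient G has mean value G(0) <> 0, which
   bounds Szego's infimum for the weight |F|^2 from below. *)
Lemma H2_neq0_ae F : H2 F -> ~ ae_circle (fun z => F z = 0) ->
  ae_circle (fun z => F z != 0).
Proof.
move=> /H2E[lF hF] F0; have iF := L2_CI lF.
pose A n := circle_integral (fun z => F z * conjc z ^+ n).
have exA : exists n, A n != 0.
  apply: contrapT => nA; apply: F0.
  have hA n : A n = 0.
    by apply/eqP; apply: contrapT => /negP An; apply: nA; exists n.
  have h1 n : circle_integral (fun z => F z * z ^+ n) = 0.
    case: n => [|n]; last exact: hF.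
    by rewrite -[RHS](hA 0%N); apply: eq_circle_integral => z _; rewrite !expr0.
  exact: (fourier_uniqueness_complex iF h1 hA).
(* This [n] is the order of the zero of [F] at the origin, and [A n] the leading Taylor
   coefficient. *)
case: (ex_minnP exA) => n An nmin.
pose G z := F z * conjc z ^+ n.
have lG : L2 G.
  apply: (@L2_bounded_mul _ _ _ 1) => //.
    by apply/circle_measurableX/circle_measurableJ; exact: circle_measurable_id.
  by move=> z z1; rewrite abscX absc_conj z1 expr1n.
have hG : H2 G.
  apply/H2E; split => // k.
  have h z j : absc z = 1 -> conjc z ^+ j * z ^+ j = 1.
    by move=> z1; rewrite -exprMn mulrC unit_conj// expr1n.
  have [nk|kn] := leqP n k.
    rewrite -[RHS](hF (k - n)%N); apply: eq_circle_integral => z z1.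
    rewrite -(subSn nk) -{1}(subnKC (leqW nk)) exprD /G -mulrA.
    by rewrite [conjc z ^+ n * _]mulrA h// mul1r.
  have [An0|An0] := eqVneq (A (n - k.+1)%N) 0; last first.
    by have := nmin _ An0; rewrite leqNgt ltn_subrL (leq_ltn_trans _ kn).
  rewrite -[RHS]An0; apply: eq_circle_integral => z z1.
  rewrite /G -{1}(subnK kn) exprD -!mulrA h// mulr1//.
pose w z := absc (F z) ^+ 2.
have w0 z : 0 <= w z by exact: sqr_ge0.
have e0 : 0 < absc (A n) ^+ 2 by rewrite exprn_gt0// absc_gt0.
have [||v [c [K [p_ [_ _ _ wpos _]]]]] := @szego_factor _ w _ w0 _ e0.
- exact: L2_absc2.
- move=> p p0.
  (* For [p.[0] = 1] the mean of [G * p] is $G(0)p(0)$, that is [A n], and its square is at most the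
     norm of [G * p], which on the circle has the modulus of [wpoly w p]. *)
  have -> : A n = circle_integral (fun z => G z * p.[z]).
    rewrite -(ev0 (fun z => _ * _)) ev_horner ?absc0// p0 mul1r ev0//.
  apply: (le_trans (mean_le_nrm2 (L2_horner p lG))).
  rewrite le_eqVlt; apply/orP; left; apply/eqP; apply: eq_cmean => z z1.
  rewrite /wpoly /G /w !abscM abscX absc_conj z1 expr1n mulr1 mulrC.
  by rewrite sqrtr_sqr ger0_norm ?absc_ge0// absc_real ger0_norm ?absc_ge0.
- apply: ae_circleS wpos => z _; rewrite /w => h; apply/eqP => F00.
  by move: h; rewrite F00 absc0 expr0n ltxx.
Qed.

End Nonvanishing.

Section Eigenvalues.
Variable R : realType.
Implicit Types (F G f : R[i] -> R[i]) (u psi : R[i] -> R) (a b c d : R[i]).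
Implicit Types p : {poly R[i]}.

(* A real trigonometric rational function with Fourier coefficients
   d * conj (a^n - b^n) for n >= 0. *)
Definition dipole a b d (z : R[i]) : R := 2 * complex.Re (d * (szego a z - szego b z)).

Lemma dipoleE a b d z : (dipole a b d z)%:C =
  d * (szego a z - szego b z) + conjc d * (conjc (szego a z) - conjc (szego b z)).
Proof.
by apply: complex_ext; rewrite /dipole
  !(cReD, cImD, cReM, cImM, cReN, cImN, cReJ, cImJ, cReC, cImC); ring.
Qed.

Lemma cmeas_dipole a b d : cmeas (dipole a b d).
Proof.
apply: cmeasM; first exact: cmeas_cst.
have [] : circle_measurable (fun z => d * (szego a z - szego b z)) => //.
apply: circle_measurableZ; apply: circle_measurableB;
exact: circle_measurable_szego.
Qed.

Lemma dipole_bound a b d : absc a < 1 -> absc b < 1 ->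
  exists M, forall z, absc z = 1 -> `|dipole a b d z| <= M.
Proof.
move=> a1 b1; exists (2 * (absc d * ((1 - absc a)^-1 + (1 - absc b)^-1))) => z z1.
rewrite /dipole normrM ger0_norm// ler_pM2l// (le_trans (normRe_absc _))// abscM.
rewrite ler_wpM2l ?absc_ge0// (le_trans (abscD _ _))// abscN.
by apply: lerD; exact: szego_bound.
Qed.

Lemma cintegrable_dipole a b d : absc a < 1 -> absc b < 1 -> cintegrable (dipole a b d).
Proof.
move=> a1 b1; have [M hM] := dipole_bound d a1 b1.
apply: (cintegrable_le (cmeas_dipole a b d) (cintegrable_cst M)).
exact: ae_circleW.
Qed.

(** The two unconjugated kernels both pair with [F] to its mean and cancel; the conjugated ones
    evaluate [F] at [a] and [b]. *)
Lemma dipole_mean a b d F : absc a < 1 -> absc b < 1 -> H2 F ->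
  circle_integral (fun z => (dipole a b d z)%:C * F z) = conjc d * (ev F a - ev F b).
Proof.
move=> a1 b1 hF; have iF := L2_CI (H2_L2 hF).
have ia := CI_szego a1 iF; have ib := CI_szego b1 iF.
have ja := CI_szegoJ a1 iF; have jb := CI_szegoJ b1 iF.
rewrite (@eq_circle_integral _ _ (fun z =>
  d * (F z * szego a z - F z * szego b z) +
  conjc d * (F z * conjc (szego a z) - F z * conjc (szego b z)))); last first.
  by move=> z _; rewrite dipoleE; ring.
rewrite circle_integralD; try by apply: CIZ; exact: CIB.
rewrite !circle_integralZ; try exact: CIB.
rewrite !circle_integralB// mean_szego// mean_szego// subrr mulr0 add0r//.
Qed.

Lemma ev_pow a n : absc a < 1 -> ev (fun z => z ^+ n) a = a ^+ n.
Proof.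
move=> a1; have := @ev_horner _ (fun=> 1) 'X^n a a1 (H2_cst 1).
have -> : ev (fun=> 1) a = 1.
  rewrite /ev (@eq_circle_integral _ _ (fun z => conjc (1 * szego a z))); last first.
    by move=> z _; rewrite mul1r mul1r.
  rewrite circle_integralJ ?mean_szego ?circle_integral_cst ?rmorph1//.
    exact: H2_cst.
  by apply: CI_szego => //; exact/L2_CI/L2_cst.
rewrite hornerXn mulr1 => <-; congr ev.
by apply/funext => z; rewrite hornerXn mul1r.
Qed.

Lemma H2_pow n : H2 (fun z : R[i] => z ^+ n).
Proof.
apply: eq_H2 (H2_horner 'X^n (H2_cst 1)) => z.
by rewrite hornerXn mul1r.
Qed.

Lemma H2t_horner a b t F p : absc a < 1 -> absc b < 1 -> p.[a] = p.[b] ->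
  H2t a b t F -> H2t a b t (fun z => F z * p.[z]).
Proof.
move=> a1 b1 pab [hF tF]; split; first exact: H2_horner.
have iF := L2_CI (H2_L2 hF); have iFp := CI_horner p iF.
move: tF; rewrite !disk_extensionE// !ev_horner// pab => ->.
by rewrite mulrCA.
Qed.

(** The conclusion mentions no [t], so that eigenvectors from different spaces become comparable.
    [psi] is a real representative of [phi] that is bounded at every point. *)
Lemma eigenvalue_dipole a b phi psi (M : R) lambda :
  absc a < 1 -> absc b < 1 -> a != b ->
  circle_measurable phi -> cmeas psi -> (forall z, `|psi z| <= M) ->
  ae_circle (fun z => phi z = (psi z)%:C) ->
  (~ exists c : R[i], ae_circle (fun z => phi z = c)) ->
  Lambda phi a b lambda ->
  exists (l : R) d f, [/\ lambda = l%:C, d != 0, L2 f, ae_circle (fun z => f z != 0) &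
    ae_circle (fun z => (psi z - l) * absc (f z) ^+ 2 = dipole a b d z)].
Proof.
move=> a1 b1 ab mphi mpsi psiM phipsi nconst [t _ [f [fH fn0 [_ [_ forth]]]]].
have hf := fH.1; have lf := H2_L2 hf.
have fne := H2_neq0_ae hf fn0.
have i2 := L2_absc2 lf.
have ipsi : cintegrable (fun z => absc (f z) ^+ 2 * psi z).
  by apply: (@cintegrable_bounded_mul _ _ _ M).
have ortho p : p.[a] = p.[b] -> circle_integral
    (fun z => ((psi z)%:C - lambda) * (absc (f z) ^+ 2)%:C * conjc p.[z]) = 0.
  move=> pab; rewrite -[RHS](forth _ (H2t_horner a1 b1 pab fH)).
  have mf := L2_meas lf; have mp := circle_measurable_horner p.
  apply: circle_integral_ae.
  - apply: circle_measurableM; last exact: circle_measurableJ.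
    apply: circle_measurableM; last by apply: circle_measurable_real; exact: cmeas_absc2.
    apply: circle_measurableB; last exact: circle_measurable_cst.
    exact: circle_measurable_real.
  - apply: circle_measurableM; last by apply: circle_measurableJ; exact: circle_measurableM.
    apply: circle_measurableB; first exact: circle_measurableM.
    exact: circle_measurableZ.
  - apply: ae_circleS phipsi => z _ ->; rewrite -mulc_conj rmorphM/=; ring.
have n0 : nrm2 f != 0.
  apply/eqP => nf0; apply: fn0.
  have := cmean_eq0 i2 (fun z _ => sqr_ge0 _) nf0.
  by apply: ae_circleS => z _ /eqP; rewrite sqrf_eq0 absc_eq0 => /eqP.
(* Testing with the constant 1 exhibits [lambda] as the mean of [psi] with weight $|f|^2$. *)
have [l lambdaE] : exists l : R, lambda = l%:C.
  exists (cmean (fun z => absc (f z) ^+ 2 * psi z) / nrm2 f).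
  have := ortho 1; rewrite !hornerC => /(_ erefl).
  rewrite (@eq_circle_integral _ _ (fun z => (absc (f z) ^+ 2 * psi z)%:C -
    lambda * (absc (f z) ^+ 2)%:C)); last first.
    by move=> z _; rewrite hornerC rmorph1 rmorphM/=; ring.
  rewrite circle_integralB; [|exact: CI_real|exact/CIZ/CI_real].
  rewrite circle_integralZ; last exact: CI_real.
  rewrite !circle_integral_real => /eqP; rewrite subr_eq0 => /eqP h.
  rewrite rmorphM/= h fmorphV/= mulfK//.
  by rewrite -(rmorph0 (real_complex R)) (inj_eq (@complexI R)).
pose u z := (psi z - l) * absc (f z) ^+ 2.
have iu : cintegrable u.
  have := cintegrableB ipsi (cintegrableZ l i2); rewrite /u.
  by under eq_fun do rewrite [absc _ ^+ 2 * _]mulrC -mulrBl.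
have iuC := CI_real iu.
have uorth p : p.[a] = p.[b] -> circle_integral (fun z => (u z)%:C * p.[z]) = 0.
  move=> /ortho h; have := congr1 (@conjc R) h; rewrite rmorph0 => <-.
  rewrite -circle_integralJ; last first.
    have := CIJ (CI_horner p iuC); apply: eq_CI => z.
    by rewrite lambdaE /u rmorphM/= oppr0 -rmorphB -rmorphM.
  apply: eq_circle_integral => z _.
  rewrite conjc_mulJ; congr (_ * _).
  by rewrite lambdaE /u -rmorphB -rmorphM/= oppr0.
pose e := circle_integral (fun z => (u z)%:C * z) / (a - b).
have ab0 : a - b != 0 by rewrite subr_eq0.
have un n : circle_integral (fun z => (u z)%:C * z ^+ n) = (a ^+ n - b ^+ n) * e.
  (* This combination of ['X^n] and ['X] takes equal values at [a] and [b], so every moment of [u]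
     is determined by the first one. *)
  pose p := (a - b) *: 'X^n - (a ^+ n - b ^+ n) *: 'X.
  have pab : p.[a] = p.[b] by rewrite /p !hornerE; ring.
  have := uorth p pab.
  rewrite (@eq_circle_integral _ _ (fun z => (a - b) * ((u z)%:C * z ^+ n) -
    (a ^+ n - b ^+ n) * ((u z)%:C * z))); last first.
    move=> z _; rewrite /p hornerD hornerN !hornerZ hornerXn hornerX.
    by move: (u z)%:C => U; ring.
  have i1 : CI (fun z => (u z)%:C * z) by apply: eq_CI (CI_unit_pow 1 iuC).
  rewrite circle_integralB; try by apply: CIZ => //; exact: CI_unit_pow.
  rewrite !circle_integralZ//; last exact: CI_unit_pow.
  move=> /eqP; rewrite subr_eq0 => /eqP h.
  by apply: (mulfI ab0); rewrite h /e; field.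
pose d := conjc e.
have uQ : ae_circle (fun z => u z = dipole a b d z).
  have iQ := cintegrable_dipole d a1 b1.
  have : ae_circle (fun z => u z - dipole a b d z = 0).
    apply: fourier_uniqueness => [|n]; first exact: cintegrableB.
    rewrite (@eq_circle_integral _ _ (fun z => (u z)%:C * z ^+ n -
      (dipole a b d z)%:C * z ^+ n)); last by move=> z _; rewrite rmorphB mulrBl.
    rewrite circle_integralB; try by apply: CI_unit_pow => //; exact: CI_real.
    rewrite un dipole_mean ?ev_pow//; last exact: H2_pow.
    by rewrite /d conjcK mulrC subrr.
  by apply: ae_circleS => z _ /eqP; rewrite subr_eq0 => /eqP.
exists l, d, f; split => //.
(* For [d = 0] the dipole is zero, and [psi] equals [l] wherever [f] is nonzero, that is almost
   everywhere. *)
apply/eqP => d0; apply: nconst; exists l%:C.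
have aeq : ae_circle (fun z => psi z = l).
  apply: ae_circle2 uQ fne => z _; rewrite d0 /dipole mul0r mulr0 /u => /eqP.
  rewrite mulf_eq0 sqrf_eq0 absc_eq0 => /orP[|/eqP->]; last by rewrite eqxx.
  by rewrite subr_eq0 => /eqP.
by apply: ae_circle2 phipsi aeq => z _ -> ->.
Qed.

End Eigenvalues.

(** * The sign of a dipole *)

Section DipoleSigns.
Variable R : realType.
Implicit Types (a b c d e : R[i]) (x y t : R).
Local Notation mu := (@lebesgue_measure R).

Lemma cisD x y : cis (x + y) = cis x * cis y.
Proof.
by rewrite /cis cosD sinD; apply: complex_ext; rewrite ?cReM ?cImM//=; ring.
Qed.

Lemma cisN x : cis (- x) = (cis x)^-1.
Proof. by rewrite unit_inv ?absc_cis// /cis cosN sinN. Qed.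

Lemma cis_2pi : cis (2 * pi) = 1 :> R[i].
Proof. by rewrite /cis mulr_natl cos2pi sin2pi. Qed.

Lemma unit_polar c : absc c = 1 -> exists t, - pi <= t <= pi /\ c = cis t.
Proof.
move=> c1; have := absc_sqr c; rewrite c1 expr1n => h.
set x := complex.Re c in h *; set y := complex.Im c in h *.
have x1 : -1 <= x <= 1.
  by rewrite -ler_norml (le_trans (normRe_absc _))// c1.
have sy : Num.sqrt (1 - x ^+ 2) = `|y|.
  by rewrite h addrC addKr sqrtr_sqr.
have [p0 pp] : 0 <= acos x /\ acos x <= pi by split; [exact: acos_ge0|exact: acos_lepi].
have pi0 := pi_ge0 R.
have [y0|y0] := leP 0 y.
  exists (acos x); split; first by rewrite pp andbT; lra.
  by apply: complex_ext => /=; rewrite ?acosK// sin_acos// sy ger0_norm.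
exists (- acos x); split; first by lra.
apply: complex_ext => /=; rewrite ?cosN ?sinN ?acosK//.
by rewrite sin_acos// sy ltr0_norm ?opprK.
Qed.

Lemma right_half_plane_polar c : 0 < complex.Re c ->
  c = (absc c)%:C * cis (atan (complex.Im c / complex.Re c)).
Proof.
move=> c0; set x := complex.Re c in c0 *; set y := complex.Im c.
have ac : absc c = x * Num.sqrt (1 + (y / x) ^+ 2).
  have -> : absc c = Num.sqrt (absc c ^+ 2) by rewrite sqrtr_sqr ger0_norm ?absc_ge0.
  rewrite absc_sqr -/x -/y.
  have -> : x ^+ 2 + y ^+ 2 = x ^+ 2 * (1 + (y / x) ^+ 2).
    by field; rewrite gt_eqF.
  by rewrite sqrtrM ?sqr_ge0// sqrtr_sqr gtr0_norm.
have s0 : Num.sqrt (1 + (y / x) ^+ 2) != 0.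
  by rewrite sqrtr_eq0 -ltNge ltr_pwDl// sqr_ge0.
apply: complex_ext; rewrite ?cReM ?cImM cReC cImC /= mul0r ?subr0 ?addr0 ac.
- by rewrite cos_atan -/x; field.
- have sA q : sin (atan q) = q * cos (atan q) :> R.
    rewrite -{2}(atanK q) /tan mulfVK// cos_atan invr_eq0.
    by rewrite sqrtr_eq0 -ltNge ltr_pwDl// sqr_ge0.
  rewrite sA cos_atan -/y; field; by rewrite s0 gt_eqF.
Qed.

(** Argument of [1 - conjc a * cis x]. For $|a| < 1$ this number stays in the right half-plane,
    where the arctangent gives the argument continuously, with values in $]-\pi/2, \pi/2[$ and no
    choice of branch. *)
Definition lift_arg a x : R :=
  atan (complex.Im (1 - conjc a * cis x) / complex.Re (1 - conjc a * cis x)).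

Lemma szego_den_Re a x : absc a < 1 -> 0 < complex.Re (1 - conjc a * cis x).
Proof.
move=> a1; rewrite cReD cReN subr_gt0 (le_lt_trans (Re_absc _))//.
by rewrite abscM absc_conj absc_cis mulr1.
Qed.

Lemma szego_polar a x : absc a < 1 ->
  szego a (cis x) = (absc (szego a (cis x)))%:C * cis (- lift_arg a x).
Proof.
move=> a1; have h := right_half_plane_polar (szego_den_Re x a1).
rewrite /szego {1}h invfM abscV fmorphV/= cisN.
by [].
Qed.

Lemma continuous_lift_arg a : absc a < 1 -> continuous (lift_arg a).
Proof.
move=> a1 x; apply: (@cvg_comp _ _ _ _ (@atan R)); last exact: continuous_atan.
have cc : cos y @[y --> x] --> cos x by exact: continuous_cos.
have cs : sin y @[y --> x] --> sin x by exact: continuous_sin.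
have EI y : complex.Im (1 - conjc a * cis y) =
    complex.Im a * cos y - complex.Re a * sin y.
  by rewrite cImD cImN cImM cReJ cImJ/=; ring.
have ER y : complex.Re (1 - conjc a * cis y) =
    1 - (complex.Re a * cos y + complex.Im a * sin y).
  by rewrite cReD cReN cReM cReJ cImJ/=; ring.
apply: cvgM.
  rewrite EI (_ : (fun y => _) = (fun y => complex.Im a * cos y - complex.Re a * sin y)).
    by apply: cvgB; apply: cvgM => //; exact: cvg_cst.
  by apply/funext => y; rewrite EI.
apply: cvgV; first by rewrite gt_eqF// szego_den_Re.
rewrite ER (_ : (fun y => _) = (fun y => 1 - (complex.Re a * cos y + complex.Im a * sin y))).
  apply: cvgB; first exact: cvg_cst.
  by apply: cvgD; apply: cvgM => //; exact: cvg_cst.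
by apply/funext => y; rewrite ER.
Qed.

(* A continuous determination of the argument of
   (szego a - szego b) / conj (a - b) along the circle. *)
Definition dipole_arg a b x : R := x - lift_arg a x - lift_arg b x.

Lemma continuous_dipole_arg a b : absc a < 1 -> absc b < 1 ->
  continuous (dipole_arg a b).
Proof.
move=> a1 b1 x; apply: cvgB; last exact: continuous_lift_arg.
by apply: cvgB; [exact: cvg_id|exact: continuous_lift_arg].
Qed.

(** On the circle $k_a - k_b = \overline{(a-b)}\, z\, k_a k_b$, so the arguments of the three
    variable factors add up to [dipole_arg]. *)
Lemma dipole_polar a b d x : absc a < 1 -> absc b < 1 -> exists2 r : R, 0 < r &
  dipole a b d (cis x) =
  r * complex.Re (d * conjc (a - b) * cis (dipole_arg a b x)).
Proof.
move=> a1 b1; have z1 := absc_cis x.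
have da := szego_den_neq0 a1 z1; have db := szego_den_neq0 b1 z1.
pose ra := absc (szego a (cis x)); pose rb := absc (szego b (cis x)).
have ra0 : 0 < ra by rewrite absc_gt0 invr_eq0.
have rb0 : 0 < rb by rewrite absc_gt0 invr_eq0.
exists (2 * (ra * rb)); first by rewrite mulr_gt0// mulr_gt0.
rewrite /dipole -mulrA; congr (_ * _).
have -> : szego a (cis x) - szego b (cis x) =
    conjc (a - b) * cis x * szego a (cis x) * szego b (cis x).
  by rewrite /szego rmorphB/=; field; rewrite da db.
rewrite [in LHS](szego_polar x a1) [in LHS](szego_polar x b1) -/ra -/rb.
have -> : cis (dipole_arg a b x) = cis x * cis (- lift_arg a x) * cis (- lift_arg b x).
  by rewrite -!cisD.
set A := cis (- lift_arg a x); set B := cis (- lift_arg b x).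
have -> : d * (conjc (a - b) * cis x * (ra%:C * A) * (rb%:C * B)) =
    (ra * rb)%:C * (d * conjc (a - b) * (cis x * A * B)).
  by rewrite rmorphM/=; ring.
by rewrite cReM cReC cImC mul0r subr0.
Qed.

(** Both [lift_arg] terms are periodic, so [dipole_arg] gains exactly $2\pi$ over one turn and the
    intermediate value theorem applies. *)
Lemma dipole_arg_surj a b t : absc a < 1 -> absc b < 1 -> - pi <= t <= pi ->
  exists2 x, 0 <= x < 2 * pi & cis (dipole_arg a b x) = cis t.
Proof.
move=> a1 b1 /andP[t1 t2]; have pi0 := pi_gt0 R.
(* At 0 only two arctangents remain. The bound ensures that [t] or [t + 2 * pi] lies in the range
   swept from the starting value. *)
have h0 : - pi < dipole_arg a b 0 < pi.
  rewrite /dipole_arg sub0r /lift_arg.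
  set X := _ / _; set Y := _ / _.
  have := atan_gtNpi2 X; have := atan_ltpi2 X.
  have := atan_gtNpi2 Y; have := atan_ltpi2 Y; lra.
have per : dipole_arg a b (2 * pi) = dipole_arg a b 0 + 2 * pi.
  rewrite /dipole_arg /lift_arg cis_2pi (_ : cis 0 = 1); first by ring.
  by rewrite /cis cos0 sin0.
have [t' ct' ht'] : exists2 t', cis t' = cis t &
    dipole_arg a b 0 <= t' <= dipole_arg a b 0 + 2 * pi.
  have [h|h] := leP (dipole_arg a b 0) t.
    by exists t => //; rewrite h/=; lra.
  by exists (t + 2 * pi); [rewrite cisD cis_2pi mulr1|lra].
have le02 : 0 <= 2 * pi :> R by lra.
have cont : {within `[0, 2 * pi], continuous (dipole_arg a b)}.
  by apply: continuous_subspaceT; exact: continuous_dipole_arg.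
have := @IVT _ _ 0 (2 * pi) t' le02 cont; rewrite per.
rewrite min_l ?lerDl// max_r ?lerDl// => /(_ ht')[x].
(* A solution at $2\pi$ is moved to 0, so that room is left to its right inside [arc]. *)
rewrite in_itv/= => /andP[x0]; rewrite le_eqVlt => /predU1P[->|x2] hx.
  exists 0; first by rewrite lexx/=; lra.
  rewrite -ct' -hx per cisD cis_2pi mulr1//.
by exists x; rewrite ?x0// hx.
Qed.

(** Take the direction of $h = \overline{e - c}$: for unit vectors the real parts of $eh$ and $ch$
    are $|h|^2/2$ and $-|h|^2/2$. *)
Lemma unit_separation c e : absc c = 1 -> absc e = 1 -> c != e ->
  exists2 t, - pi <= t <= pi &
    0 < complex.Re (e * cis t) /\ complex.Re (c * cis t) < 0.
Proof.
move=> c1 e1 ce; pose h := conjc (e - c).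
have h0 : 0 < absc h by rewrite absc_gt0 conjc_eq0 subr_eq0 eq_sym.
have [t [ht hE]] : exists t, - pi <= t <= pi /\ h / (absc h)%:C = cis t.
  apply: unit_polar; rewrite abscM abscV absc_real ger0_norm ?absc_ge0//.
  by rewrite mulfV// gt_eqF.
exists t => //.
have k (x : R[i]) : complex.Re (x * cis t) = (absc h)^-1 * complex.Re (x * h).
  rewrite -hE -fmorphV/= mulrA cReM cReC cImC mulr0 subr0 mulrC//.
have i0 : 0 < (absc h)^-1 by rewrite invr_gt0.
rewrite !k (pmulr_rgt0 _ i0) (pmulr_rlt0 _ i0).
have := absc_sqr c; have := absc_sqr e; have := absc_sqr h.
have hh : 0 < absc h ^+ 2 by rewrite exprn_gt0.
rewrite c1 e1; move: hh; move: (absc h ^+ 2) => H hh.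
rewrite /h !cReM !cReJ !cImJ !cReD !cImD !cReN !cImN.
set x1 := complex.Re c; set y1 := complex.Im c.
set x2 := complex.Re e; set y2 := complex.Im e.
rewrite expr1n => E1 E2 E3.
have E4 : H = x2 ^+ 2 + y2 ^+ 2 + (x1 ^+ 2 + y1 ^+ 2) - 2 * (x1 * x2 + y1 * y2).
  by rewrite E1; ring.
rewrite -E2 -E3 in E4.
split; lra.
Qed.

(** If [d1] and [d2] had different directions, some angle would make the second dipole positive and
    the first negative. By continuity this persists on an interval of positive length, which the
    null exceptional set cannot contain. *)
Lemma dipole_separation a b d1 d2 : absc a < 1 -> absc b < 1 -> a != b ->
  d1 != 0 -> d2 != 0 ->
  ae_circle (fun z => 0 < dipole a b d2 z -> 0 <= dipole a b d1 z) ->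
  exists2 r : R, 0 < r & d2 = r%:C * d1.
Proof.
move=> a1 b1 ab d10 d20 [N [mN N0 hN]].
have k0 : conjc (a - b) != 0 by rewrite conjc_eq0 subr_eq0.
pose e d := d * conjc (a - b) / (absc (d * conjc (a - b)))%:C.
have ae0 d : d != 0 -> 0 < absc (d * conjc (a - b)).
  by move=> dn0; rewrite absc_gt0 mulf_neq0.
have e1 d : d != 0 -> absc (e d) = 1.
  move=> dn0; rewrite abscM abscV absc_real ger0_norm ?absc_ge0//.
  by rewrite mulfV// gt_eqF// ae0.
have [ee|en] := eqVneq (e d1) (e d2).
  exists (absc (d2 * conjc (a - b)) / absc (d1 * conjc (a - b))).
    by rewrite divr_gt0// ae0.
  have nz d : d != 0 -> (absc (d * conjc (a - b)))%:C != 0 :> R[i].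
    by move=> /ae0 h; rewrite -(rmorph0 (real_complex R)) (inj_eq (@complexI R)) gt_eqF.
  apply: (mulIf k0); apply: (mulIf (invr_neq0 (nz _ d20))).
  have -> : d2 * conjc (a - b) / (absc (d2 * conjc (a - b)))%:C = e d2 by [].
  rewrite -ee /e rmorphM fmorphV/=.
  have n1 := nz _ d10; have n2 := nz _ d20.
  by field; rewrite n1 n2.
exfalso; have [t ht [h2 h1]] := unit_separation (e1 _ d10) (e1 _ d20) en.
have [x /andP[x0 x2] hx] := dipole_arg_surj a1 b1 ht.
pose G d y := complex.Re (d * conjc (a - b) * cis (dipole_arg a b y)).
have cG d : continuous (G d).
  have -> : G d = (fun y => complex.Re (d * conjc (a - b)) *
      cos (dipole_arg a b y) - complex.Im (d * conjc (a - b)) * sin (dipole_arg a b y)).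
    by apply/funext => y; rewrite /G cReM.
  move=> y.
  have ct := @continuous_dipole_arg a b a1 b1 y.
  apply: cvgB; apply: cvgM; try exact: cvg_cst.
  - by apply: cvg_comp ct _; exact: continuous_cos.
  - by apply: cvg_comp ct _; exact: continuous_sin.
have Ge d : d != 0 -> complex.Re (e d * cis t) = G d x / absc (d * conjc (a - b)).
  move=> dn0; rewrite /G /e hx -fmorphV/= mulrAC cReM cReC cImC mulr0 subr0//.
rewrite Ge// pmulr_lgt0 ?invr_gt0 ?ae0// in h2.
rewrite Ge// pmulr_llt0 ?invr_gt0 ?ae0// in h1.
have : \forall y \near x, 0 < G d2 y /\ G d1 y < 0.
  by apply: filterI; [exact: (cvgr_gt _ (cG d2 x))|exact: (cvgr_lt _ (cG d1 x))].
move=> /nbhs_ballP[eps /= eps0 hb].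
pose s := Num.min (x + eps) (2 * pi).
have xs : x < s by rewrite lt_min ltrDl eps0.
have sub : `]x, s[ `<=` N.
  move=> y; rewrite /= in_itv/= => /andP[xy ys].
  have yeps : y < x + eps by rewrite (lt_le_trans ys)// ge_min lexx.
  have y2 : y < 2 * pi by rewrite (lt_le_trans ys)// ge_min lexx orbT.
  have [g2 g1] : 0 < G d2 y /\ G d1 y < 0.
    by apply: hb; rewrite /ball/= ltr_distlC; apply/andP; split; lra.
  apply: hN => /= h.
  have ay : @Defs.arc R y by rewrite /Defs.arc/= in_itv/= (ltW y2) andbT; lra.
  have [r2 r20 E2] := dipole_polar d2 y a1 b1.
  have [r1 r10 E1] := dipole_polar d1 y a1 b1.
  have := h ay; rewrite E2 E1 => /(_ _).
  rewrite pmulr_rgt0// => /(_ g2); rewrite pmulr_rge0// leNgt => /negP; exact.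
have : (mu (`]x, s[%classic : set (measurableTypeR R)) <= mu N)%E.
  by apply: le_measure => //; rewrite inE//; exact: measurable_itv.
rewrite [X in (_ <= X)%E]N0 lebesgue_measure_itv/= lte_fin xs -EFinD lee_fin.
by rewrite subr_le0 leNgt xs.
Qed.

End DipoleSigns.

(** * From dipoles to eigenvectors *)

Section IntermediateEigenvalue.
Variable R : realType.
Implicit Types (F G f h : R[i] -> R[i]) (w psi : R[i] -> R) (a b c d : R[i]).
Implicit Types p : {poly R[i]}.

Lemma not_ae_circle_false : ~ ae_circle (fun _ : R[i] => False).
Proof.
move=> h; have h' : ae_circle (fun _ : R[i] => 1 = 0 :> R) by apply: ae_circleS h.
have := @cmean_ae R (fun=> 1) (fun=> 0) (cmeas_cst _) (cmeas_cst _) h'.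
by rewrite !cmean_cst => /eqP; rewrite oner_eq0.
Qed.

Lemma eq_ev F G a : (forall z, absc z = 1 -> F z = G z) -> ev F a = ev G a.
Proof. by move=> FG; apply: eq_circle_integral => z z1; rewrite FG. Qed.

Lemma ev_cst c a : absc a < 1 -> ev (fun=> c) a = c.
Proof.
move=> a1; have := ev_pow 0 a1; rewrite expr0 => h.
rewrite (@eq_ev _ (fun z => c * z ^+ 0)); last by move=> z _; rewrite expr0 mulr1.
by rewrite evZ ?h ?mulr1//; exact: (L2_CI (H2_L2 (H2_pow _ 0))).
Qed.

Lemma L2_szegoJ a : absc a < 1 -> L2 (fun z => conjc (szego a z)).
Proof.
move=> a1; apply: L2J; apply: (@eq_L2 _ (fun z => 1 * szego a z)).
  by move=> z; rewrite mul1r.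
apply: (L2_bounded_mul (L2_cst 1) (circle_measurable_szego a)) => z z1.
exact: szego_bound.
Qed.

Lemma absc_ev F a : absc a < 1 -> L2 F ->
  absc (ev F a) ^+ 2 <= nrm2 F * nrm2 (fun z => conjc (szego a z)).
Proof. by move=> a1 lF; apply: cauchy_schwarz => //; exact: L2_szegoJ. Qed.

(** Numerator of the dipole: on the circle it equals $z|D|^2 Q$ with $D = (1-\bar a z)(1-\bar b z)$,
    because $z - a = z\,\overline{(1-\bar a z)}$ there. Being a polynomial, it has its value at 0 as
    its mean. *)
Definition dipole_num a b d : {poly R[i]} :=
  (d * conjc (a - b)) *: (('X - a%:P) * ('X - b%:P)) +
  (conjc (d * conjc (a - b))) *: ((1 - conjc a *: 'X) * (1 - conjc b *: 'X)).

Lemma dipole_numE a b d z : absc a < 1 -> absc b < 1 -> absc z = 1 ->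
  absc (dipole_num a b d).[z] =
  `|dipole a b d z| * absc ((1 - conjc a * z) * (1 - conjc b * z)) ^+ 2.
Proof.
move=> a1 b1 z1; set D := (1 - conjc a * z) * _.
have da := szego_den_neq0 a1 z1; have db := szego_den_neq0 b1 z1.
have dJa := szego_denJ_neq0 a1 z1; have dJb := szego_denJ_neq0 b1 z1.
have DJ : conjc D = (1 - a * conjc z) * (1 - b * conjc z).
  by rewrite /D rmorphM !rmorphB !rmorph1 !rmorphM/= !conjcK.
have zz := unit_conj z1.
have -> : (dipole_num a b d).[z] = z * ((dipole a b d z)%:C * (D * conjc D)).
  rewrite /dipole_num !hornerE dipoleE !szegoJ DJ /szego /D.
  rewrite rmorphM/= conjcK rmorphB/=.
  have -> : z - a = z * (1 - a * conjc z) by rewrite mulrBr mulrCA zz !mulr1.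
  have -> : z - b = z * (1 - b * conjc z) by rewrite mulrBr mulrCA zz !mulr1.
  set A := 1 - conjc a * z in da *; set B := 1 - conjc b * z in db *.
  set A' := 1 - a * conjc z in dJa *; set B' := 1 - b * conjc z in dJb *.
  have e1 : A^-1 - B^-1 = (conjc a - conjc b) * z / (A * B).
    by rewrite /A /B; field; rewrite -/A -/B da db.
  have e2 : A'^-1 - B'^-1 = (a - b) * conjc z / (A' * B').
    by rewrite /A' /B'; field; rewrite -/A' -/B' dJa dJb.
  rewrite e1 e2.
  transitivity (d * (conjc a - conjc b) * z * z * A' * B' +
    conjc d * (a - b) * (z * conjc z) * A * B); last by field; rewrite da db dJa dJb.
  by rewrite zz; ring.
rewrite abscM z1 mul1r abscM absc_real mulc_conj absc_real.
by rewrite [`|absc _ ^+ 2|]ger0_norm ?sqr_ge0.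
Qed.

(** With $k = d\,\overline{(a-b)}$ the value is $kab + \bar k$, and $|ab| < 1$ prevents
    cancellation. *)
Lemma dipole_num0 a b d : absc a < 1 -> absc b < 1 -> a != b -> d != 0 ->
  (dipole_num a b d).[0] != 0.
Proof.
move=> a1 b1 ab d0; set k := d * conjc (a - b).
have k0 : 0 < absc k by rewrite absc_gt0 mulf_neq0// conjc_eq0 subr_eq0.
have -> : (dipole_num a b d).[0] = k * (a * b) + conjc k.
  by rewrite /dipole_num -/k !hornerE/=; move: (conjc k) => kJ; ring.
apply/eqP => /eqP; rewrite addr_eq0 => /eqP /(congr1 (@absc R)).
rewrite abscN absc_conj (abscM k) (abscM a) => h.
have : absc k * (absc a * absc b) < absc k.
  rewrite gtr_pMr// (le_lt_trans _ a1)// ler_piMr ?absc_ge0// ltW//.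
by rewrite h ltxx.
Qed.

Lemma absc_den_le a b z : absc a < 1 -> absc b < 1 -> absc z = 1 ->
  absc ((1 - conjc a * z) * (1 - conjc b * z)) ^+ 2 <= 16.
Proof.
move=> a1 b1 z1.
have h c : absc c < 1 -> absc (1 - conjc c * z) <= 2.
  move=> c1; rewrite (le_trans (abscD _ _))// abscN absc1 abscM absc_conj z1.
  by rewrite mulr1; lra.
rewrite abscM (_ : 16 = (2 * 2) ^+ 2); last by ring.
by rewrite lerXn2r ?nnegrE ?mulr_ge0 ?absc_ge0// ler_pM ?absc_ge0// h.
Qed.

(* With |f|^2 = w and (psi - l) w the dipole, pairing (psi - l) f with h in H2
   gives, along the extremal polynomials p_n ~ 1 / f, the limit of
   conj d * (p_n(a) h(a) - p_n(b) h(b)), which vanishes when h(a) = t h(b) for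
   t = f(a) / f(b). *)
Lemma dipole_eigenvalue a b d phi psi w (M l : R) :
  absc a < 1 -> absc b < 1 -> a != b -> d != 0 ->
  circle_measurable phi -> cmeas psi -> (forall z, `|psi z| <= M) ->
  ae_circle (fun z => phi z = (psi z)%:C) ->
  (forall z, 0 <= w z) -> cintegrable w ->
  ae_circle (fun z => (psi z - l) * w z = dipole a b d z) ->
  Lambda phi a b l%:C.
Proof.
move=> a1 b1 ab d0 mphi mpsi psiM phipsi w0 iw wQ.
have psilM z : `|psi z - l| <= M + `|l|.
  by rewrite (le_trans (ler_normB _ _))// lerD2r.
have ML0 : 0 <= M + `|l| by apply: le_trans (psilM 0).
(* 16 bounds the squared denominators, [M + |l|] bounds [|psi - l|], and the final 1 only makes [C]
   positive. *)
pose q := dipole_num a b d; pose C := 16 * (M + `|l|) + 1.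
have C0 : 0 < C by rewrite /C; lra.
have qw : ae_circle (fun z => absc q.[z] <= C * w z).
  apply: ae_circleS wQ => z z1 wQ; rewrite /q dipole_numE// -wQ normrM.
  rewrite (ger0_norm (w0 z)).
  have h1 : `|psi z - l| * w z <= (M + `|l|) * w z by rewrite ler_wpM2r.
  have h2 := absc_den_le a1 b1 z1.
  have h3 : 0 <= `|psi z - l| * w z by rewrite mulr_ge0.
  apply: (le_trans (ler_wpM2l h3 h2)).
  have := w0 z; rewrite /C; lra.
pose eps := absc q.[0] / C.
have eps0 : 0 < eps by rewrite divr_gt0// absc_gt0 dipole_num0.
have lw p : L2 (wpoly w p) by exact: L2_wpoly.
(* Since $|q| \le Cw$, the norm is at least $C^{-1}$ times the mean of $|q p^2|$, and the polynomial
   $q p^2$ has mean $q(0)$. *)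
have lower p : p.[0] = 1 -> eps <= nrm2 (wpoly w p).
  move=> p0; rewrite /eps ler_pdivrMr// mulrC.
  have -> : q.[0] = circle_integral (fun z => 1 * (q * p ^+ 2).[z]).
    rewrite -ev0 ev_horner ?absc0//; last exact: H2_cst.
    by rewrite ev_cst ?absc0// hornerM horner_exp p0 expr1n !mulr1.
  have iq := CI_horner (q * p ^+ 2) (L2_CI (L2_cst (1 : R[i]))).
  apply: (le_trans (absc_circle_integral iq)).
  rewrite /nrm2 -cmeanZ; last exact: L2_absc2.
  apply: cmean_le; [exact: CI_absc|by apply: cintegrableZ; exact: L2_absc2|].
  apply: ae_circleS qw => z _ qw.
  rewrite mul1r hornerM horner_exp abscM abscX /wpoly abscM absc_real exprMn.
  by rewrite real_normK ?num_real// sqr_sqrtr// [leRHS]mulrCA [leLHS]mulrC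
    ler_wpM2l ?sqr_ge0.
have [v [c [K [p_ [lv c0 vc wpos [vK hf]]]]]] := szego_factor w0 iw eps0 lower.
set f := (fun z => conjc (v z) * (Num.sqrt (w z))%:C) in hf.
have lf := H2_L2 hf; have iF := L2_CI lf.
have lvB n : L2 (fun z => v z - wpoly w (p_ n) z) by exact: L2B.
(* As $c = v\bar v$, the difference is $-\bar v (v - p_n\sqrt w)$: up to the factor [c], the [p_ n]
   are approximate inverses of [f]. *)
have fpn n : nrm2 (fun z => f z * (p_ n).[z] - c%:C) <= c * K * 4^-1 ^+ n.
  have -> : nrm2 (fun z => f z * (p_ n).[z] - c%:C) =
      c * nrm2 (fun z => v z - wpoly w (p_ n) z).
    rewrite /nrm2 -cmeanZ; last exact: L2_absc2.
    apply: cmean_ae.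
    - apply: cmeas_absc2; apply: circle_measurableB; last exact: circle_measurable_cst.
      by apply: circle_measurableM; [exact: L2_meas|exact: circle_measurable_horner].
    - by apply: cmeasM; [exact: cmeas_cst|apply: cmeas_absc2; exact: L2_meas].
    - apply: ae_circleS vc => z _ vc.
      rewrite -{1}vc -mulc_conj /f.
      have -> : conjc (v z) * (Num.sqrt (w z))%:C * (p_ n).[z] - v z * conjc (v z) =
        - (conjc (v z) * (v z - wpoly w (p_ n) z)) by rewrite /wpoly; ring.
      by rewrite abscN abscM exprMn absc_conj vc.
  by rewrite -mulrA ler_pM2l.
have evp x n : absc x < 1 -> absc ((p_ n).[x] * ev f x - c%:C) ^+ 2 <=
    c * K * nrm2 (fun z => conjc (szego x z)) * 4^-1 ^+ n.
  move=> x1.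
  have lp : L2 (fun z => f z * (p_ n).[z]) by exact: L2_horner.
  have -> : (p_ n).[x] * ev f x - c%:C = ev (fun z => f z * (p_ n).[z] - c%:C) x.
    by rewrite evB ?ev_horner ?ev_cst//; [exact: L2_CI|exact/L2_CI/L2_cst].
  apply: (le_trans (absc_ev x1 (L2B lp (L2_cst _)))).
  rewrite [leRHS]mulrAC ler_wpM2r ?nrm2_ge0//.
(* A zero of [f] at [x] would contradict $p_n(x) f(x) \to c > 0$. *)
have evn0 x : absc x < 1 -> ev f x != 0.
  move=> x1; apply/eqP => fx0.
  have : c ^+ 2 = 0.
    apply: (@geometric_le0 _ _ (c * K * nrm2 (fun z => conjc (szego x z)))).
      exact: sqr_ge0.
    move=> n; have := evp x n x1; rewrite fx0 mulr0 sub0r abscN absc_real.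
    by rewrite real_normK ?num_real.
  by move/eqP; rewrite sqrf_eq0 gt_eqF.
have fa0 := evn0 a a1; have fb0 := evn0 b b1.
pose t := ev f a / ev f b.
have t0 : t != 0 by rewrite mulf_neq0// invr_eq0.
have Hft : H2t a b t f by split => //; rewrite !disk_extensionE// /t mulfVK.
have Hlft : H2t a b t (fun z => l%:C * f z).
  split; first exact: H2Z.
  rewrite !disk_extensionE//; try exact: CIZ.
  by rewrite !evZ// /t; field.
exists t => //; exists f; split => //.
  have fpos : ae_circle (fun z => 0 < absc (f z) ^+ 2).
    apply: ae_circle2 vc wpos => z _ vc wz; rewrite /f abscM exprMn absc_conj vc.
    by rewrite absc_real real_normK ?num_real// sqr_sqrtr// mulr_gt0.
  move=> fz; apply: not_ae_circle_false; apply: ae_circle2 fz fpos => z _ ->.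
  by rewrite absc0 expr0n ltxx.
split => //; split => // h [hh th].
have lh := H2_L2 hh; have ih := L2_CI lh.
rewrite !disk_extensionE// in th.
have [MQ hMQ] := dipole_bound d a1 b1.
(* [G] is square-integrable although [w] may be unbounded, because $(\psi - l)^2 w = (\psi - l) Q$
   is bounded. The inner product to be annihilated is the conjugate of the integral of [v * G]. *)
pose G z := ((psi z - l) * Num.sqrt (w z))%:C * h z.
have mG : circle_measurable G.
  apply: circle_measurableM; last exact: L2_meas.
  apply: circle_measurable_real; apply: cmeasM.
    by apply: cmeasB => //; exact: cmeas_cst.
  by apply: cmeas_sqrt; exact: cintegrable_meas.
have lG : L2 G.
  apply: (L2_le mG (cintegrableZ ((M + `|l|) * MQ) (L2_absc2 lh))).
  apply: ae_circleS wQ => z z1 wQ.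
  rewrite /G abscM absc_real exprMn ler_wpM2r ?sqr_ge0//.
  rewrite real_normK ?num_real// exprMn sqr_sqrtr// expr2 -mulrA wQ.
  apply: (le_trans (ler_norm _)); rewrite normrM.
  by apply: ler_pM => //; exact: hMQ.
(* The product is $Q\,h\,p_n$. Inserting $h(a) = t\,h(b)$ leaves $p_n(a)f(a) - p_n(b)f(b)$, two
   terms with the same limit [c]; subtracting [c] from each displays the decay. *)
have In n : circle_integral (fun z => wpoly w (p_ n) z * G z) =
    conjc d * (ev h b / ev f b) *
    (((p_ n).[a] * ev f a - c%:C) - ((p_ n).[b] * ev f b - c%:C)).
  transitivity (circle_integral (fun z => (dipole a b d z)%:C * (h z * (p_ n).[z]))).
    apply: circle_integral_ae.
    - by apply: circle_measurableM => //; exact: L2_meas.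
    - apply: circle_measurableM; first by apply: circle_measurable_real; exact: cmeas_dipole.
      by apply: circle_measurableM; [exact: L2_meas|exact: circle_measurable_horner].
    - apply: ae_circleS wQ => z _ <-; rewrite /wpoly /G.
      have -> : (psi z - l) * w z = (psi z - l) * Num.sqrt (w z) * Num.sqrt (w z).
        by rewrite -mulrA -expr2 sqr_sqrtr.
      rewrite rmorphM/=; ring.
  rewrite dipole_mean//; last exact: H2_horner.
  rewrite !ev_horner// th /t; by field.
pose I := circle_integral (fun z => v z * G z).
have I0 : I = 0.
  apply/eqP; rewrite -absc_eq0 -sqrf_eq0; apply/eqP.
  pose A := c * K * nrm2 (fun z => conjc (szego a z)).
  pose B := c * K * nrm2 (fun z => conjc (szego b z)).
  pose k := absc (conjc d * (ev h b / ev f b)) ^+ 2.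
  apply: (@geometric_le0 _ _ (2 * (K * nrm2 G) + 2 * (k * (2 * A + 2 * B)))).
    exact: sqr_ge0.
  move=> n; pose J := circle_integral (fun z => wpoly w (p_ n) z * G z).
  have h1 : absc (I - J) ^+ 2 <= K * 4^-1 ^+ n * nrm2 G.
    rewrite /I /J -circle_integralB; try exact: L2_CI_mul.
    rewrite (@eq_circle_integral _ _ (fun z => (v z - wpoly w (p_ n) z) * G z)); last first.
      by move=> z _; rewrite mulrBl.
    apply: (le_trans (cauchy_schwarz (lvB n) lG)).
    by rewrite ler_wpM2r ?nrm2_ge0.
  have h2 : absc J ^+ 2 <= k * ((2 * A + 2 * B) * 4^-1 ^+ n).
    rewrite /J In abscM exprMn -/k ler_wpM2l ?sqr_ge0//.
    apply: (le_trans (absc_sqrD _ _)); rewrite abscN.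
    have := evp a n a1; have := evp b n b1; rewrite -/A -/B; lra.
  have := absc_sqrD (I - J) J; rewrite subrK; lra.
have IJ : circle_integral (fun z => conjc (v z * G z)) = 0.
  by rewrite circle_integralJ; [rewrite -/I I0 rmorph0|exact: L2_CI_mul].
rewrite /inner -[RHS]IJ.
apply: circle_integral_ae.
- apply: circle_measurableM; last by apply: circle_measurableJ; exact: L2_meas.
  apply: circle_measurableB.
    by apply: circle_measurableM => //; exact: L2_meas.
  by apply: circle_measurableZ; exact: L2_meas.
- by apply: circle_measurableJ; apply: circle_measurableM => //; exact: L2_meas.
- apply: ae_circleS phipsi => z _ ->; rewrite /G /f.
  apply: complex_ext;
  rewrite !(cReD, cImD, cReM, cImM, cReN, cImN, cReJ, cImJ, cReC, cImC); ring.
Qed.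

(** Where the dipole is positive, [psi - l] exceeds [psi - l2 > 0], so the weight is below
    $|f_2|^2$; where it is negative, the weight is below $|f_1|^2$ in the same way. *)
Lemma intermediate_eigenvalue a b d phi psi f1 f2 (M l l1 l2 : R) :
  absc a < 1 -> absc b < 1 -> a != b -> d != 0 ->
  circle_measurable phi -> cmeas psi -> (forall z, `|psi z| <= M) ->
  ae_circle (fun z => phi z = (psi z)%:C) ->
  l1 < l -> l < l2 -> L2 f1 -> L2 f2 ->
  ae_circle (fun z => f1 z != 0) -> ae_circle (fun z => f2 z != 0) ->
  ae_circle (fun z => (psi z - l1) * absc (f1 z) ^+ 2 = dipole a b d z) ->
  ae_circle (fun z => (psi z - l2) * absc (f2 z) ^+ 2 = dipole a b d z) ->
  Lambda phi a b l%:C.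
Proof.
move=> a1 b1 ab d0 mphi mpsi psiM phipsi l1l ll2 lf1 lf2 f10 f20 E1 E2.
(* The quotient is positive only almost everywhere; the absolute value makes the weight nonnegative
   at every point. *)
pose w z := `|dipole a b d z / (psi z - l)|.
have mw : cmeas w.
  apply: cmeas_norm; apply: cmeasM; first exact: cmeas_dipole.
  by apply: cmeasV; apply: cmeasB => //; exact: cmeas_cst.
have good : ae_circle (fun z => (psi z - l) * w z = dipole a b d z /\
    w z <= absc (f1 z) ^+ 2 + absc (f2 z) ^+ 2).
  have H := ae_circle2 (fun z _ (P : f1 z != 0) (Q : f2 z != 0) => conj P Q) f10 f20.
  have H' := ae_circle2 (fun z _ P Q => conj P Q) E1 E2.
  apply: ae_circle2 H H' => z _ [n1 n2] [e1 e2].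
  rewrite /w; set Q := dipole a b d z in e1 e2 *.
  have A0 : 0 < absc (f1 z) ^+ 2 by rewrite exprn_gt0// absc_gt0.
  have B0 : 0 < absc (f2 z) ^+ 2 by rewrite exprn_gt0// absc_gt0.
  move: (absc (f1 z) ^+ 2) (absc (f2 z) ^+ 2) A0 B0 e1 e2 => A B A0 B0 e1 e2.
  have [Q0|Q0|Q0] := ltgtP Q 0.
  - have p1 : psi z - l1 < 0 by move: Q0; rewrite -e1 pmulr_llt0.
    have pl : psi z - l < 0 by lra.
    have Qp : 0 < Q / (psi z - l) by rewrite nmulr_rgt0// invr_lt0.
    rewrite gtr0_norm//; split; first by rewrite mulrCA mulfV ?mulr1// lt_eqF.
    rewrite ler_ndivrMr//.
    have h1 : A * (psi z - l) <= A * (psi z - l1) by rewrite ler_pM2l//; lra.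
    have h2 : B * (psi z - l) <= 0 by rewrite pmulr_rle0// ltW.
    rewrite -e1 mulrDl [(psi z - l1) * A]mulrC; lra.
  - have p1 : 0 < psi z - l2 by move: Q0; rewrite -e2 pmulr_lgt0.
    have pl : 0 < psi z - l by lra.
    have Qp : 0 < Q / (psi z - l) by rewrite divr_gt0.
    rewrite gtr0_norm//; split; first by rewrite mulrCA mulfV ?mulr1// gt_eqF.
    rewrite ler_pdivrMr//.
    have h1 : B * (psi z - l2) <= B * (psi z - l) by rewrite ler_pM2l//; lra.
    have h2 : 0 <= A * (psi z - l) by rewrite pmulr_rge0// ltW.
    rewrite -e2 [leRHS]mulrDl [(psi z - l2) * B]mulrC; lra.
  - exfalso; move: e1 e2; rewrite Q0 => /eqP; rewrite mulf_eq0 (gt_eqF A0) orbF.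
    rewrite subr_eq0 => /eqP h1 /eqP; rewrite mulf_eq0 (gt_eqF B0) orbF subr_eq0.
    by move=> /eqP h2; lra.
apply: (@dipole_eigenvalue a b d phi psi w M l) => //.
- by move=> z; exact: normr_ge0.
- apply: (cintegrable_le mw (cintegrableD (L2_absc2 lf1) (L2_absc2 lf2))).
  by apply: ae_circleS good => z _ [_]; rewrite normr_id.
- by apply: ae_circleS good => z _ [].
Qed.

End IntermediateEigenvalue.

Lemma continuous_real_complex (R : realType) :
  continuous (fun x : R => (x%:C : R[i]^o)).
Proof.
move=> x; apply/cvgrPdist_lt => e e0.
have [e1 e2] : complex.Im e = 0 /\ 0 < complex.Re e.
  by move: e0; rewrite ltcE/= => /andP[/eqP-> ->].
near=> y; rewrite [`|_|]normC_absc -rmorphB/= absc_real ltcE/= e1 eqxx/=.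
by near: y; apply: cvgr_dist_lt.
Unshelve. all: by end_near. Qed.

Theorem theorem5p12 (R : realType) (a b : R[i]) (phi : R[i] -> R[i])
  (ha : `|a| < 1) (hb : `|b| < 1) (hab : a <> b)
  (hphi : Linfty phi)
  (hreal : ae_circle (fun z => complex.Im (phi z) = 0))
  (hnonconst : ~ exists c : R[i], ae_circle (fun z => phi z = c)) :
  [\/ Lambda phi a b = set0,
      exists x : R, Lambda phi a b = [set x%:C] |
      exists J : set R,
        [/\ is_interval J, exists x y : R, [/\ J x, J y & x < y] &
            Lambda phi a b = [set x%:C | x in J]]] /\
  connected (Lambda phi a b : set R[i]^o).
Proof.
have a1 : absc a < 1 by rewrite -ltcR -normC_absc.
have b1 : absc b < 1 by rewrite -ltcR -normC_absc.
have ab : a != b by exact/eqP.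
have [mphi [M phiM]] := hphi.
(* Truncation replaces the essential bound and almost sure reality of [phi] by ones valid
   everywhere. *)
pose psi z := if `|complex.Re (phi z)| <= `|M| then complex.Re (phi z) else 0.
have mpsi : cmeas psi.
  apply: cmeas_if; [|exact: mphi.1|exact: cmeas_cst].
  apply: (@measurable_fun_ler _ _ _ _
    (fun x => `|complex.Re (phi (cis x))|) (fun=> `|M|)).
    exact: (@cmeas_norm R (fun z => complex.Re (phi z)) mphi.1).
  exact: measurable_cst.
have psiM z : `|psi z| <= `|M|.
  by rewrite /psi; case: ifPn => //; rewrite normr0.
have phipsi : ae_circle (fun z => phi z = (psi z)%:C).
  apply: ae_circle2 hreal phiM => z _ im0 pM; rewrite /psi ifT.
    exact: complex_ext.
  rewrite (le_trans (normRe_absc _))// (le_trans _ (ler_norm _))//.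
  by rewrite -lecR -normC_absc.
have key := fun lambda => @eigenvalue_dipole R a b phi psi `|M| lambda a1 b1 ab
  mphi mpsi psiM phipsi hnonconst.
pose J : set R := [set x | Lambda phi a b x%:C].
have LJ : Lambda phi a b = [set x%:C | x in J].
  apply/seteqP; split => [lambda hl|_ [x Jx <-] //].
  have [l [d [f [lE _ _ _ _]]]] := key _ hl.
  by exists l => //; rewrite /J/= -lE.
have Jitv : is_interval J.
  move=> x y Jx Jy z /andP[]; rewrite le_eqVlt => /predU1P[<-//|xz].
  rewrite le_eqVlt => /predU1P[->//|zy].
  have [l1 [d1 [f1 [/complexI E1 d10 lf1 f10 Q1]]]] := key _ Jx.
  have [l2 [d2 [f2 [/complexI E2 d20 lf2 f20 Q2]]]] := key _ Jy.
  rewrite -{l1}E1 in Q1; rewrite -{l2}E2 in Q2.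
  have xy : x < y by exact: lt_trans zy.
  have [r r0 d2E] : exists2 r : R, 0 < r & d2 = r%:C * d1.
    apply: (dipole_separation a1 b1 ab d10 d20).
    (* If the dipole at the larger eigenvalue [y] is positive, then [psi > y > x], so the one at [x]
       is nonnegative. *)
    apply: ae_circle2 Q1 Q2 => s _ <- <- h.
    have A0 := sqr_ge0 (absc (f2 s)).
    have ps : 0 < psi s - y.
      by move: h; apply: contraTT; rewrite -!leNgt => ?; rewrite mulr_le0_ge0.
    by apply: mulr_ge0; [lra|exact: sqr_ge0].
  (* Scaling [f2] by [k] divides $|f_2|^2$ by [r], which turns the dipole of [d2] into that of
     [d1]. *)
  pose k := (Num.sqrt r)^-1.
  have k0 : 0 < k by rewrite invr_gt0 sqrtr_gt0.
  have k2 : k ^+ 2 = r^-1 by rewrite exprVn sqr_sqrtr// ltW.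
  apply: (@intermediate_eigenvalue R a b d1 phi psi f1 (fun s => k%:C * f2 s)
    `|M| z x y) => //.
  - exact: L2Z.
  - apply: ae_circleS f20 => s _ f20; rewrite mulf_neq0//.
    by rewrite -absc_gt0 absc_real normr_gt0 gt_eqF.
  - apply: ae_circleS Q2 => s _ Q2.
    rewrite abscM exprMn absc_real real_normK ?num_real// k2 mulrCA Q2 d2E.
    rewrite /dipole -[_ * d1 * _]mulrA cReM cReC cImC mul0r subr0.
    by rewrite [2 * (r * _)]mulrCA mulKf// gt_eqF.
have conn : connected (Lambda phi a b : set R[i]^o).
  rewrite LJ; apply: (@connected_continuous_connected _ R[i]^o _
    (fun x : R => x%:C : R[i]^o)).
    exact/connected_intervalP.
  by apply: continuous_subspaceT; exact: continuous_real_complex.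
split => //.
have [J2|J2] := pselect (exists x y : R, [/\ J x, J y & x < y]).
  by constructor 3; exists J.
have [J0|J0] := pselect (exists x, J x); last first.
  constructor 1; rewrite LJ; apply/seteqP; split => [y [x Jx _]|//].
  by exfalso; apply: J0; exists x.
have [x Jx] := J0; constructor 2; exists x; rewrite LJ.
apply/seteqP; split => [_ [y Jy <-]|_ ->]; last by exists x.
have [xy|yx|->//] := ltgtP x y; exfalso; apply: J2.
- by exists x, y.
- by exists y, x.
Qed.
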